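(* Let $N,M,K\in\mathbb{N}$, let $p_1,\dots,p_K>0$ with $\sum_{k=1}^K p_k=1$, and let $\mathbf C_1,\dots,\mathbf C_K\in\mathbb{C}^{N\times N}$ be covariance matrices (Hermitian positive semidefinite). Let $\mathbf h\in\mathbb{C}^N$ have the zero-mean Gaussian mixture density $p(\mathbf h)=\sum_{k=1}^K p_k\,\mathcal{N}_{\mathbb{C}}(\mathbf h;\mathbf 0,\mathbf C_k)$, with global covariance $\mathbf C_{\mathbf h}=\sum_{k=1}^K p_k\mathbf C_k$. Let $\mathbf a\in\mathbb{C}^M$ with $\|\mathbf a\|_2^2=M$, $\mathbf A=\mathbf a\otimes \mathbf I_N\in\mathbb{C}^{NM\times N}$, and let $\mathbf n\sim\mathcal{N}_{\mathbb{C}}(\mathbf 0,\eta^2\mathbf I_{NM})$ with $\eta^2>0$ be independent of $\mathbf h$. Set $\mathbf y=\mathbf A\mathbf h+\mathbf n$ and $\mathbf r=Q(\mathbf y)$, where $Q(x)=\frac{1}{\sqrt2}(\operatorname{sign}(\operatorname{Re}x)+\mathrm{j}\operatorname{sign}(\operatorname{Im}x))$ is applied element-wise. Define $\mathbf C_{\mathbf y|k}=\mathbf A\mathbf C_k\mathbf A^{\mathrm H}+\eta^2\mathbf I$, $\mathbf C_{\mathbf y}=\sum_{k=1}^K p_k\mathbf C_{\mathbf y|k}$, and $\bar{\mathbf C}_{\mathbf y|k}=\operatorname{diag}(\mathbf C_{\mathbf y|k})^{-1/2}\mathbf C_{\mathbf y|k}\operatorname{diag}(\mathbf C_{\mathbf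 y|k})^{-1/2}$. Then the Bussgang gain $\mathbf B:=\mathbb{E}[\mathbf r\mathbf y^{\mathrm H}]\,\mathbb{E}[\mathbf y\mathbf y^{\mathrm H}]^{-1}$, the cross-covariance $\mathbf C_{\mathbf h\mathbf r}:=\mathbb{E}[\mathbf h\mathbf r^{\mathrm H}]$ and the covariance $\mathbf C_{\mathbf r}:=\mathbb{E}[\mathbf r\mathbf r^{\mathrm H}]$ are given by $$\mathbf B=\sqrt{\tfrac{2}{\pi}}\sum_{k=1}^K p_k\operatorname{diag}(\mathbf C_{\mathbf y|k})^{-1/2}\mathbf C_{\mathbf y|k}\mathbf C_{\mathbf y}^{-1},\qquad \mathbf C_{\mathbf h\mathbf r}=\sqrt{\tfrac{2}{\pi}}\sum_{k=1}^K p_k\mathbf C_k\mathbf A^{\mathrm H}\operatorname{diag}(\mathbf C_{\mathbf y|k})^{-1/2},$$ $$\mathbf C_{\mathbf r}=\frac{2}{\pi}\sum_{k=1}^K p_k\Big(\sin^{-1}\big(\operatorname{Re}(\bar{\mathbf C}_{\mathbf y|k})\big)+\mathrm{j}\,\sin^{-1}\big(\operatorname{Im}(\bar{\mathbf C}_{\mathbf y|k})\big)\Big),$$ where $\sin^{-1}$ is applied element-wise. (These are the quantities in the linear MMSE estimator $\hat{\mathbf h}=\mathbf C_{\mathbf h\mathbf r}\mathbf C_{\mathbf r}^{-1}\mathbf r$.)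
   Context: $\operatorname{diag}(\mathbf X)$ denotes the diagonal matrix with the diagonal of $\mathbf X$; $\mathcal N_{\mathbb C}(\mathbf 0,\mathbf C)$ is the circularly symmetric complex Gaussian distribution with covariance $\mathbf C$; $\otimes$ is the Kronecker product; $\mathbf n$ is the column-wise vectorization of $M$ i.i.d. noise vectors, so $\mathbf y$ is the vectorization of $\mathbf h\mathbf a^{\mathrm T}+[\mathbf n_1,\dots,\mathbf n_M]$. *)

(* Defs.v *)
From HB Require Import structures.
From mathcomp Require Import all_boot all_order all_algebra.
From mathcomp Require Import all_classical all_reals all_analysis.
From mathcomp Require Import complex mxtens.
Set Implicit Arguments. Unset Strict Implicit. Unset Printing Implicit Defensive.
Import Order.TTheory GRing.Theory Num.Theory.
Local Open Scope ring_scope.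
Local Open Scope complex_scope.
Local Open Scope classical_set_scope.

Section Defs.
Variable R : realType.
Local Notation C := R[i].

Definition cconj (z : C) : C := (complex.Re z) -i* (complex.Im z).
Definition hermt m n (X : 'M[C]_(m, n)) : 'M[C]_(n, m) := (map_mx cconj X)^T.

Definition herm_psd n (X : 'M[C]_n) : Prop :=
  hermt X = X /\ forall v : 'cV[C]_n, 0 <= (hermt v *m X *m v) 0 0.

Definition kronI M N (a : 'cV[C]_M) : 'M[C]_(M * N, N) :=
  castmx (erefl (M * N)%N, mul1n N) (a *t (1%:M : 'M[C]_N)).

Definition Qc (x : C) : C :=
  ((Num.sg (complex.Re x)) +i* (Num.sg (complex.Im x))) / (Num.sqrt (2 : R))%:C.
Definition Qvec n (x : 'cV[C]_n) : 'cV[C]_n := map_mx Qc x.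

(* diag(X)^{-1/2}: diagonal matrix with entries 1/sqrt(X_ii) (X_ii real > 0) *)
Definition diag_isqrt n (X : 'M[C]_n) : 'M[C]_n :=
  diag_mx (\row_i ((Num.sqrt (complex.Re (X i i)))^-1)%:C).

Definition asin_cmx m n (X : 'M[C]_(m, n)) : 'M[C]_(m, n) :=
  \matrix_(i, j) ((asin (complex.Re (X i j))) +i* (asin (complex.Im (X i j)))).

(* characteristic function of N_C(0, Cov):  w |-> exp(- w^H Cov w / 4) *)
Definition cgauss_cf n (Cov : 'M[C]_n) (w : 'cV[C]_n) : C :=
  (expR (- complex.Re ((hermt w *m Cov *m w) 0 0) / 4))%:C.

Definition gmix_cf K n (p : 'I_K -> R) (Cs : 'I_K -> 'M[C]_n) (w : 'cV[C]_n) : C :=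
  \sum_(k < K) (p k)%:C * cgauss_cf (Cs k) w.

Variables (d : measure_display) (T : measurableType d).

Definition cmx_measurable m n (X : T -> 'M[C]_(m, n)) : Prop :=
  forall i j, measurable_fun setT (fun t => complex.Re (X t i j)) /\
              measurable_fun setT (fun t => complex.Im (X t i j)).

Definition cE (P : probability T R) m n (X : T -> 'M[C]_(m, n)) : 'M[C]_(m, n) :=
  \matrix_(i, j) ((Rintegral P setT (fun t => complex.Re (X t i j))) +i*
                  (Rintegral P setT (fun t => complex.Im (X t i j)))).

Definition cvec_cf (P : probability T R) n (X : T -> 'cV[C]_n) (w : 'cV[C]_n) : C :=
  (Rintegral P setT (fun t => cos (complex.Re ((hermt w *m X t) 0 0)))) +i*
  (Rintegral P setT (fun t => sin (complex.Re ((hermt w *m X t) 0 0)))).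

(* the law of X is the one with characteristic function phi *)
Definition has_cf (P : probability T R) n (X : T -> 'cV[C]_n) (phi : 'cV[C]_n -> C) :=
  forall w, cvec_cf P X w = phi w.

Definition cmx_sigma m n (X : T -> 'M[C]_(m, n)) : set (set T) :=
  <<s [set A | exists i j, exists2 B : set R, measurable B &
         (A = (fun t => complex.Re (X t i j)) @^-1` B \/ A = (fun t => complex.Im (X t i j)) @^-1` B)] >>.

Definition cindep (P : probability T R) m n m' n'
    (X : T -> 'M[C]_(m, n)) (Y : T -> 'M[C]_(m', n')) : Prop :=
  forall A B, cmx_sigma X A -> cmx_sigma Y B -> P (A `&` B) = (P A * P B)%E.

End Defs.

(* Main.v *)
Require Import Defs.
From HB Require Import structures.
From mathcomp Require Import all_boot all_order all_algebra.
From mathcomp Require Import all_classical all_reals all_analysis.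
From mathcomp Require Import complex mxtens.
From mathcomp Require Import measurable_realfun ring lra.

Set Implicit Arguments. Unset Strict Implicit. Unset Printing Implicit Defensive.
Import Order.TTheory GRing.Theory Num.Theory.
Import numFieldNormedType.Exports.
Local Open Scope ring_scope.
Local Open Scope classical_set_scope.

(** Every real or imaginary part of an entry of [h] or [y] is a real linear functional of the pair
    ([h], [n]), and every matrix entry to be computed combines expectations of X Y, sg(X) Y or sg(X)
    sg(Y) for two such functionals X and Y. By independence, E cos(s X + t Y) = sum_k p_k exp(-(a_k
    s^2 + 2 c_k s t + b_k t^2) / 2), with a_k, b_k and c_k the variances and the covariance under
    component k ([cf_lin], [lin_mixture]). All expectations are extracted from this identity,
    without densities, so singular covariances cause no special case, and the mixture is carried
    along by linearity.

    Product moments come from second differences of the characteristic function at 0 and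
    polarization ([mixture_second_moment], [mixture_moment]). Signs are removed by Dirichlet's
    formula sg x = (1/pi) int sin(s x)/s ds, regularized by exp(-e |s|) ([Rintegral_sgr_inversion]).
    Since E[sin(s X) Y] = sum_k p_k c_k s exp(-a_k s^2 / 2), one inversion leaves Gaussian integrals
    and gives E[sg(X) Y] = sqrt(2/pi) sum_k p_k c_k / sqrt(a_k) ([mixture_sgr_mul]). Two inversions
    reduce E[sg(X) sg(Y)] to the double integrals of exp(-(a_k s^2 + b_k t^2) / 2) sinh(c_k s t) /
    (s t). For c_k = sqrt(a_k b_k) sin(theta) such an integral is 2 pi theta
    ([integral_orthant_kernel]), whence the arcsine law [mixture_sgr_sgr].

    Back in complex form, circular symmetry makes the two real products in an entry of an outer
    product contribute equally, and the noise makes all variances of [y] positive. This yields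
    [cE_yy], [cE_ry], [cE_hr] and [cE_rr]; the Bussgang gain is then [cE_ry] times the inverse of
    [cE_yy]. *)

(** * Measurability of elementary functions, inverse and sign *)

Section measurability.
Context d (T : measurableType d) (R : realType).
Implicit Type f : T -> R.

Lemma measurable_fun_cos f : measurable_fun setT f -> measurable_fun setT (fun x => cos (f x)).
Proof.
move=> mf; apply: (measurableT_comp (f := cos)) => //.
by apply: continuous_measurable_fun; exact: continuous_cos.
Qed.

Lemma measurable_fun_sin f : measurable_fun setT f -> measurable_fun setT (fun x => sin (f x)).
Proof.
move=> mf; apply: (measurableT_comp (f := sin)) => //.
by apply: continuous_measurable_fun; exact: continuous_sin.
Qed.

Lemma measurable_fun_atan f : measurable_fun setT f -> measurable_fun setT (fun x => atan (f x)).
Proof.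
move=> mf; apply: (measurableT_comp (f := atan)) => //.
by apply: continuous_measurable_fun; exact: continuous_atan.
Qed.

Lemma measurable_fun_expR f : measurable_fun setT f -> measurable_fun setT (fun x => expR (f x)).
Proof. by move=> mf; exact: measurableT_comp. Qed.

Lemma measurable_fun_norm f : measurable_fun setT f -> measurable_fun setT (fun x => `|f x|).
Proof. by move=> mf; exact: measurableT_comp. Qed.

(** These quotients are continuous in [x] and converge everywhere, also at 0, where both sides
    vanish by the convention [0^-1 = 0]. Inversion is thus a pointwise limit of continuous
    functions, hence measurable. *)
Lemma cvg_harmonic_inv (x : R) : x / (x ^+ 2 + n.+1%:R^-1) @[n --> \oo] --> x^-1.
Proof.
have [->|x0] := eqVneq x 0.
  by rewrite invr0; under eq_fun do rewrite mul0r; exact: cvg_cst.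
rewrite -[X in _ --> X](_ : x / (x ^+ 2 + 0) = x^-1); last by field.
apply: cvgM; first exact: cvg_cst.
apply: cvgV; first by rewrite addr0 expf_neq0.
by apply: cvgD; [exact: cvg_cst|exact: cvg_harmonic].
Qed.

Lemma measurable_fun_invr f : measurable_fun setT f -> measurable_fun setT (fun x => (f x)^-1).
Proof.
move=> mf; apply: (measurable_fun_cvg (h := fun n x => f x / (f x ^+ 2 + n.+1%:R^-1))).
  move=> n; apply: (measurableT_comp (f := fun y : R => y / (y ^+ 2 + n.+1%:R^-1))) => //.
  apply: continuous_measurable_fun => y.
  apply: cvgM; first exact: cvg_id.
  apply: cvgV; first by rewrite gt_eqF// ltr_wpDl ?sqr_ge0.
  by apply: cvgD; [exact: exprn_continuous|exact: cvg_cst].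
by move=> x _; exact: cvg_harmonic_inv.
Qed.

Lemma sgr_normV (x : R) : Num.sg x = x * `|x|^-1.
Proof.
have [->|x0] := eqVneq x 0; first by rewrite sgr0 mul0r.
by rewrite {2}(numEsg x) mulfK// normr_eq0.
Qed.

Lemma measurable_fun_sgr f : measurable_fun setT f -> measurable_fun setT (fun x => Num.sg (f x)).
Proof.
move=> mf; under eq_fun do rewrite sgr_normV.
by apply: measurable_funM => //; apply: measurable_fun_invr; exact: measurable_fun_norm.
Qed.

End measurability.

Ltac mfun := repeat first
  [ assumption | exact: measurable_cst | exact: measurable_id
  | exact: measurable_fst | exact: measurable_snd
  | apply: measurable_fun_cos | apply: measurable_fun_sin
  | apply: measurable_fun_atan | apply: measurable_fun_expR
  | apply: measurable_fun_norm | apply: measurable_fun_invr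
  | apply: measurable_fun_sgr
  | apply: measurable_funD | apply: measurable_funB
  | apply: measurable_funM | apply: measurable_funN | apply: measurable_funX
  | apply: measurableT_comp measurable_fst
  | apply: measurableT_comp measurable_snd ].

(** * Integrals of real-valued functions *)

Definition Rintegrable d (T : measurableType d) (R : realType)
    (mu : {measure set T -> \bar R}) (f : T -> R) :=
  mu.-integrable setT (EFin \o f).

Section Rint.
Context d (T : measurableType d) (R : realType) (mu : {measure set T -> \bar R}).
Implicit Types f g : T -> R.

Lemma Rintegrable_measurable f : Rintegrable mu f -> measurable_fun setT f.
Proof. by move=> /measurable_int /measurable_EFinP. Qed.

Lemma Rintegrable_le f g : measurable_fun setT f -> (forall x, `|f x| <= g x) ->
  Rintegrable mu g -> Rintegrable mu f.
Proof.
move=> mf fg; apply: le_integrable => //; first exact/measurable_EFinP.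
by move=> x _ /=; rewrite lee_fin (le_trans (fg x))// ler_norm.
Qed.

Lemma RintegrableD f g : Rintegrable mu f -> Rintegrable mu g ->
  Rintegrable mu (fun x => f x + g x).
Proof. by move=> fi gi; exact: (integrableD measurableT fi gi). Qed.

Lemma RintegrableB f g : Rintegrable mu f -> Rintegrable mu g ->
  Rintegrable mu (fun x => f x - g x).
Proof. by move=> fi gi; exact: (integrableB measurableT fi gi). Qed.

Lemma RintegrableZl c f : Rintegrable mu f -> Rintegrable mu (fun x => c * f x).
Proof. by move=> fi; exact: (integrableZl measurableT c fi). Qed.

Lemma RintegrableZr c f : Rintegrable mu f -> Rintegrable mu (fun x => f x * c).
Proof. by move=> fi; exact: (integrableZr measurableT c fi). Qed.

Lemma Rintegrable_norm f : Rintegrable mu f -> Rintegrable mu (fun x => `|f x|).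
Proof. by move=> fi; exact: (integrable_norm fi). Qed.

Lemma Rintegrable_sum (I : finType) (F : I -> T -> R) :
  (forall i, Rintegrable mu (F i)) -> Rintegrable mu (fun x => \sum_i F i x).
Proof.
move=> Fi; rewrite /Rintegrable (_ : _ \o _ = fun x => (\sum_i (F i x)%:E)%E).
  by apply: integrable_sum => // i _; exact: Fi.
by apply/funext => x /=; rewrite sumEFin.
Qed.

Lemma Rintegral_sum (I : finType) (F : I -> T -> R) :
  (forall i, Rintegrable mu (F i)) ->
  \int[mu]_x (\sum_i F i x) = \sum_i \int[mu]_x F i x.
Proof.
move=> Fi.
(* Integrability of the partial sums travels through the induction, because additivity of the
   integral asks for it at each step. *)
suff H (s : seq I) : Rintegrable mu (fun x => \sum_(i <- s) F i x) /\
    \int[mu]_x (\sum_(i <- s) F i x) = \sum_(i <- s) \int[mu]_x F i x.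
  exact: (H _).2.
elim: s => [|i s [IH1 IH2]].
  split; last first.
    by under eq_Rintegral do rewrite big_nil; rewrite big_nil Rintegral_cst// mul0r.
  rewrite /Rintegrable (_ : _ \o _ = cst 0%E); first exact: integrable0.
  by apply/funext => x /=; rewrite big_nil.
have E : (fun x => \sum_(j <- i :: s) F j x) = (fun x => F i x + \sum_(j <- s) F j x).
  by apply/funext => x; rewrite big_cons.
rewrite E big_cons; split; first exact: RintegrableD.
by rewrite (RintegralD measurableT (Fi i) IH1) IH2.
Qed.

Lemma Rintegral_EFin f : Rintegrable mu f -> (\int[mu]_x (f x)%:E)%E = (\int[mu]_x f x)%:E.
Proof. by move=> fi; rewrite /Rintegral fineK// integrable_fin_num. Qed.

Lemma Rintegral_dominated (f_ : nat -> T -> R) f g :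
  (forall n, measurable_fun setT (f_ n)) ->
  (forall x, f_ n x @[n --> \oo] --> f x) ->
  Rintegrable mu g -> (forall n x, `|f_ n x| <= g x) ->
  Rintegrable mu f /\ \int[mu]_x f_ n x @[n --> \oo] --> \int[mu]_x f x.
Proof.
move=> mf_ f_f gi f_g.
have mf : measurable_fun setT f by apply: (measurable_fun_cvg (h := f_)).
have [] := @dominated_convergence _ T R mu setT measurableT (fun n => EFin \o f_ n)
  (EFin \o f) (EFin \o g).
- by move=> n; exact/measurable_EFinP.
- exact/measurable_EFinP.
- by apply: aeW => x _; apply: cvg_EFin; [exact: nearW|exact: f_f].
- exact: gi.
- by apply: aeW => x n _; rewrite lee_fin.
move=> fi _ cv; split => //.
by apply: fine_cvg; rewrite fineK ?integrable_fin_num.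
Qed.

Lemma Rintegral_normE f : measurable_fun setT f ->
  Rintegrable mu f <-> (\int[mu]_x `|f x|%:E < +oo)%E.
Proof.
move=> mf; split=> [/integrableP[]//|foo]; apply/integrableP; split => //.
exact/measurable_EFinP.
Qed.

End Rint.

Lemma Rintegrable_bounded d (T : measurableType d) (R : realType) (P : probability T R)
  (f : T -> R) (M : R) : measurable_fun setT f -> (forall x, `|f x| <= M) -> Rintegrable P f.
Proof.
move=> mf fM; apply: (@Rintegrable_le _ _ _ _ _ (cst M)) => //.
by apply: finite_measure_integrable_cst.
Qed.

(** * Exchange of integrals under a product bound *)

Section fubini.
Context d1 d2 (T1 : measurableType d1) (T2 : measurableType d2) (R : realType).
Variables (m1 : {sigma_finite_measure set T1 -> \bar R})
  (m2 : {sigma_finite_measure set T2 -> \bar R}).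
Variables (f : T1 * T2 -> R) (g1 : T1 -> R) (g2 : T2 -> R).
Hypothesis mf : measurable_fun setT f.
Hypotheses (i1 : Rintegrable m1 g1) (i2 : Rintegrable m2 g2).
Hypothesis fg : forall x y, `|f (x, y)| <= g1 x * g2 y.

Let f1 x : Rintegrable m2 (fun y => f (x, y)).
Proof.
apply: (Rintegrable_le _ (fg x)); first exact: measurable_fun_pair2.
exact: RintegrableZl.
Qed.

Let f2 y : Rintegrable m1 (fun x => f (x, y)).
Proof.
apply: (Rintegrable_le _ (fun x => fg x y)); first exact: measurable_fun_pair1.
exact: RintegrableZr.
Qed.

(** By Tonelli only the iterated integral of |f| has to be finite, and the product bound keeps it
    below the integral of |g1| times that of |g2|. All later exchanges for signed integrands rest on
    such a bound. *)
Lemma Rintegrable_prod : (m1 \x m2)%E.-integrable setT (EFin \o f).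
Proof.
apply/integrable12ltyP; first exact/measurable_EFinP.
apply: (@le_lt_trans _ _ (\int[m1]_x ((fun x => `|g1 x| * \int[m2]_y `|g2 y|) x)%:E)%E); last first.
  have : Rintegrable m1 (fun x => `|g1 x| * \int[m2]_y `|g2 y|).
    by apply: RintegrableZr; exact: Rintegrable_norm.
  by move=> h; rewrite (Rintegral_EFin h) ltry.
apply: ge0_le_integral => //.
- by move=> x _; apply: integral_ge0.
- apply: (measurable_fun_fubini_tonelli_F (m2 := m2) (abse \o (EFin \o f))) => //.
  + by apply: measurableT_comp => //; exact/measurable_EFinP.
  + by move=> x; exact: abse_ge0.
- by apply: measurableT_comp => //; apply: measurable_funM => //; apply: measurable_fun_norm;
    exact: (Rintegrable_measurable i1).
- move=> x _; rewrite -RintegralZl//; last exact: Rintegrable_norm.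
  rewrite -Rintegral_EFin; last by apply: RintegrableZl; exact: Rintegrable_norm.
  apply: ge0_le_integral => //.
  + apply: measurableT_comp => //; apply/measurable_EFinP.
    exact: measurable_fun_pair2.
  + apply: measurableT_comp => //; apply: measurable_funM => //; apply: measurable_fun_norm.
    exact: (Rintegrable_measurable i2).
  + by move=> y _; rewrite lee_fin (le_trans (fg x y))// -normrM ler_norm.
Qed.

Lemma Rintegrable_fubini : Rintegrable m1 (fun x => \int[m2]_y f (x, y)).
Proof.
have := integrable_fubini_F Rintegrable_prod; congr (_.-integrable _ _).
by apply/funext => x; rewrite /fubini_F /= (Rintegral_EFin (f1 _)).
Qed.

Lemma Rintegral_prod :
  \int[m1]_x (\int[m2]_y f (x, y)) = fine (\int[m1 \x m2]_z (f z)%:E).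
Proof.
rewrite -(integral12_prod_meas1 Rintegrable_prod) /Rintegral; congr fine.
by apply: eq_integral => x _; rewrite /fubini_F /= -(Rintegral_EFin (f1 x)).
Qed.

Lemma Rfubini : \int[m1]_x (\int[m2]_y f (x, y)) = \int[m2]_y (\int[m1]_x f (x, y)).
Proof.
have := Fubini Rintegrable_prod.
under eq_integral do rewrite /= (Rintegral_EFin (f1 _)).
under [RHS]eq_integral do rewrite /= (Rintegral_EFin (f2 _)).
by rewrite /Rintegral => ->.
Qed.

End fubini.

(** * Fourier transform of the two-sided exponential *)

Section laplace.
Variable R : realType.
Notation mu := (@lebesgue_measure R).
Implicit Types e u x s : R.

Lemma cvgy_expRN e : 0 < e -> expR (- (e * s)) @[s --> +oo] --> (0 : R).
Proof.
move=> e0; apply: (cvg_comp (fun s : R => e * s) (fun s => expR (- s))).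
  exact: gt0_cvgMry.
exact: cvgr_expR.
Qed.

(** Antiderivative in [s] of exp(-e s) (1 + cos(s u)), normalized to vanish at infinity. *)
Definition laplace_primitive e u s : R :=
  expR (- (e * s)) * ((u * sin (s * u) - e * cos (s * u)) / (e ^+ 2 + u ^+ 2) - e^-1).

Lemma is_derive_laplace_primitive e u s : 0 < e ->
  is_derive s 1 (laplace_primitive e u) (expR (- (e * s)) * (1 + cos (s * u))).
Proof.
move=> e0; rewrite /laplace_primitive.
apply: is_derive_eq.
rewrite /GRing.scale/=.
have := e0; have : 0 < e ^+ 2 + u ^+ 2 by rewrite ltr_wpDr ?sqr_ge0// exprn_gt0.
move=> /lt0r_neq0 ? /lt0r_neq0 ?.
by field; exact/andP.
Qed.

Lemma cvgy_laplace_primitive e u : 0 < e -> laplace_primitive e u s @[s --> +oo] --> (0 : R).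
Proof.
move=> e0.
pose M := (`|u| + e) / (e ^+ 2 + u ^+ 2) + e^-1.
apply/norm_cvg0P.
apply: (squeeze_cvgr (f := cst 0) (h := fun s => expR (- (e * s)) * M)).
- apply: nearW => s; rewrite normr_ge0/= /laplace_primitive normrM ger0_norm ?expR_ge0//.
  rewrite ler_wpM2l ?expR_ge0// (le_trans (ler_normB _ _))//.
  rewrite /M lerD//; last by rewrite gtr0_norm ?invr_gt0.
  have d0 : 0 < e ^+ 2 + u ^+ 2 by rewrite ltr_wpDr ?sqr_ge0// exprn_gt0.
  rewrite normrM [X in _ * X]gtr0_norm ?invr_gt0// ler_pM2r ?invr_gt0//.
  rewrite (le_trans (ler_normB _ _))// lerD//.
    by rewrite normrM ler_piMr// ler_norml sin_geN1 sin_le1.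
  by rewrite normrM (gtr0_norm e0) ler_piMr ?cos_max// ltW.
- exact: cvg_cst.
- by rewrite -[X in _ --> X](mul0r M); apply: cvgM; [exact: cvgy_expRN|exact: cvg_cst].
Qed.

Lemma continuous_expR_lin e : continuous (fun s : R => expR (- (e * s))).
Proof.
move=> s; apply: (@continuous_comp _ _ _ (fun s : R => - (e * s)) expR); last exact: continuous_expR.
by apply: cvgN; apply: cvgM; [exact: cvg_cst|exact: cvg_id].
Qed.

Lemma continuous_cos_lin u : continuous (fun s : R => cos (s * u)).
Proof.
move=> s; apply: (@continuous_comp _ _ _ (fun s : R => s * u) cos); last exact: continuous_cos.
by apply: cvgM; [exact: cvg_id|exact: cvg_cst].
Qed.

(* The weight [1 + cos] is nonnegative, as required by the fundamental theorem of calculus on a half-line. *)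
Lemma integral_laplace_1Dcos e u : 0 < e ->
  (\int[mu]_s (expR (- (e * `|s|)) * (1 + cos (s * u)))%:E =
   (2 * (e^-1 + e / (e ^+ 2 + u ^+ 2)))%:E)%E.
Proof.
move=> e0.
have c0 s : 0 <= 1 + cos (s * u) by rewrite -lerBlDl sub0r cos_geN1.
have cont (g : R -> R) : continuous g ->
    continuous (fun s => expR (- (e * g s)) * (1 + cos (s * u))).
  move=> cg s; apply: cvgM.
    by apply: (@continuous_comp _ _ _ g (fun s => expR (- (e * s)))); [exact: cg|exact: continuous_expR_lin].
  by apply: cvgD; [exact: cvg_cst|exact: continuous_cos_lin].
rewrite ge0_symfun_integralT//.
- rewrite (_ : [set x | _] = `[0, +oo[%classic); last first.
    by apply/seteqP; split => x/=; rewrite in_itv/= andbT.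
  have -> : (\int[mu]_(s in `[0%R, +oo[) (expR (- (e * `|s|)) * (1 + cos (s * u)))%:E =
      \int[mu]_(s in `[0%R, +oo[) (expR (- (e * s)) * (1 + cos (s * u)))%:E)%E.
    by apply: eq_integral => s; rewrite inE/= in_itv/= andbT => s0; rewrite ger0_norm.
  have dF s := is_derive_laplace_primitive u s e0.
  rewrite (@ge0_continuous_FTC2y _ _ (laplace_primitive e u) 0 0).
  + rewrite -EFinD -EFinM; congr (_%:E).
    rewrite /laplace_primitive mulr0 mul0r oppr0 expR0 sin0 cos0.
    have : 0 < e ^+ 2 + u ^+ 2 by rewrite ltr_wpDr ?sqr_ge0// exprn_gt0.
    by move=> /lt0r_neq0 ?; move: e0 => /lt0r_neq0 ?; field; exact/andP.
  + by move=> s _; rewrite mulr_ge0 ?expR_ge0.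
  + by apply: continuous_subspaceT; apply: (cont id) => s; exact: cvg_id.
  + exact: cvgy_laplace_primitive.
  + by move=> s _; exact: ex_derive.
  + apply: cvg_at_right_filter; apply: differentiable_continuous; apply/derivable1_diffP.
    exact: ex_derive.
  + by move=> s _; rewrite derive1E; apply: derive_val.
- by apply: cont; exact: norm_continuous.
- by move=> s /=; rewrite normrN mulNr cosN.
Qed.

Lemma Rintegrable_laplace_1Dcos e u : 0 < e ->
  Rintegrable mu (fun s => expR (- (e * `|s|)) * (1 + cos (s * u))).
Proof.
move=> e0; apply/Rintegral_normE; first by mfun.
have H s : 0 <= expR (- (e * `|s|)) * (1 + cos (s * u)).
  by rewrite mulr_ge0 ?expR_ge0// -lerBlDl sub0r cos_geN1.
under eq_integral do rewrite (ger0_norm (H _)).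
by rewrite integral_laplace_1Dcos// ltry.
Qed.

Lemma Rintegrable_laplace e : 0 < e -> Rintegrable mu (fun s => expR (- (e * `|s|))).
Proof.
move=> e0; have := RintegrableZl 2^-1 (Rintegrable_laplace_1Dcos 0 e0).
by congr (Rintegrable _ _); apply/funext => s; rewrite mulr0 cos0; field.
Qed.

(** The cosine integral is the [1 + cos] integral minus the plain exponential one, and the latter is
    half of the [1 + cos] integral at frequency 0. *)
Lemma Rintegral_laplace_cos e u : 0 < e ->
  \int[mu]_s (expR (- (e * `|s|)) * cos (s * u)) = 2 * e / (e ^+ 2 + u ^+ 2).
Proof.
move=> e0; have i0 := Rintegrable_laplace e0.
have E v : \int[mu]_s (expR (- (e * `|s|)) * (1 + cos (s * v))) =
    2 * (e^-1 + e / (e ^+ 2 + v ^+ 2)).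
  by rewrite /Rintegral integral_laplace_1Dcos.
have E0 : \int[mu]_s (expR (- (e * `|s|))) = 2 / e.
  have := E 0; under eq_Rintegral do rewrite mulr0 cos0 mulrC.
  rewrite RintegralZl//; move: e0 => /lt0r_neq0 ? H.
  by apply: (@mulfI _ (1 + 1)) => //; rewrite H; field.
transitivity (\int[mu]_s (expR (- (e * `|s|)) * (1 + cos (s * u)) - expR (- (e * `|s|)))).
  by apply: eq_Rintegral => s _; ring.
rewrite RintegralB//; last exact: Rintegrable_laplace_1Dcos.
by rewrite E E0 mulrDr addrAC subrr add0r mulrA.
Qed.

End laplace.

(** * Primitives on intervals and the regularized Dirichlet integral *)

Section calculus.
Variable R : realType.
Notation mu := (@lebesgue_measure R).
Implicit Types (F f : R -> R) (a b x : R).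

(** The mean value point is left unlocated, so that [a] and [b] may come in either order. *)
Lemma global_MVT F f a b : (forall x : R, is_derive x 1 F (f x)) ->
  exists c, F b - F a = f c * (b - a).
Proof.
move=> dF.
have H x y : x <= y -> exists c, F y - F x = f c * (y - x).
  move=> xy; have [c _ ->] := @MVT_segment _ F f x y xy (fun z _ => dF z)
    (derivable_within_continuous (fun z _ => @ex_derive _ _ _ _ _ _ _ (dF z))).
  by exists c.
have [/H//|/ltW/H[c E]] := leP a b.
by exists c; rewrite -opprB E; ring.
Qed.

Lemma norm_sin_le x : `|sin x| <= `|x|.
Proof.
have [c] := @global_MVT sin cos 0 x (fun x => is_derive_sin x).
by rewrite sin0 !subr0 => ->; rewrite normrM ler_piMl// cos_max.
Qed.

Lemma is_derive_continuous F f : (forall x : R, is_derive x 1 F (f x)) -> continuous F.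
Proof.
by move=> dF x; apply: differentiable_continuous; apply/derivable1_diffP; exact: ex_derive.
Qed.

Lemma integral_itv_primitive F f a b : a <= b -> continuous f ->
  (forall x : R, is_derive x 1 F (f x) : Prop) ->
  (\int[mu]_(x in `[a, b]) (f x)%:E = (F b - F a)%:E)%E.
Proof.
rewrite le_eqVlt => /predU1P[-> _ _|ab cf dF].
  by rewrite set_itv1 integral_set1 subrr.
have cF := is_derive_continuous dF.
rewrite (@continuous_FTC2 _ f F a b ab) ?EFinB//.
- exact: continuous_subspaceT.
- split.
  + by move=> x _; exact: ex_derive.
  + by apply: cvg_at_right_filter; exact: cF.
  + by apply: cvg_at_left_filter; exact: cF.
- by move=> x _; rewrite derive1E; exact: derive_val.
Qed.

(** The interval enters as an indicator, so that the integral runs over the whole line and fits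
    [Rfubini]. *)
Lemma Rintegral_indic_primitive F f a b : a <= b -> continuous f ->
  (forall x : R, is_derive x 1 F (f x) : Prop) ->
  \int[mu]_x (f x * \1_`[a, b] x) = F b - F a.
Proof.
move=> ab cf dF.
have := integral_itv_primitive ab cf dF.
rewrite integral_mkcond => E; rewrite /Rintegral.
suff -> : (\int[mu]_x (f x * \1_`[a, b] x)%:E = (F b - F a)%:E)%E by [].
rewrite -E; apply: eq_integral => x _.
by rewrite patchE indicE; case: ifPn => _; rewrite ?mulr1 ?mulr0.
Qed.

(** Quotients by [s] have only a conventional value at 0; as a point is a null set, identities
    between integrands need checking only off 0. *)
Lemma Rintegral_punctured f g : measurable_fun setT f -> measurable_fun setT g ->
  (forall x, x != 0 -> f x = g x) -> \int[mu]_x f x = \int[mu]_x g x.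
Proof.
move=> mf mg fg; rewrite /Rintegral; congr fine; apply: ae_eq_integral => //.
- exact/measurable_EFinP.
- exact/measurable_EFinP.
- exists [set 0]; split => //; first exact: lebesgue_measure_set1.
  move=> x /= h; apply: contrapT => /eqP x0; apply: h => _ /=.
  by rewrite fg.
Qed.

(** Write sin(s x)/s as the integral of cos(s u) over u in [0, x] and exchange: the [s]-integral is
    2 e / (e^2 + u^2), whose primitive is 2 atan(u / e). *)
Lemma Rintegral_laplace_sin_ge0 e x : 0 < e -> 0 <= x ->
  \int[mu]_s (expR (- (e * `|s|)) * (sin (s * x) / s)) = 2 * atan (x / e).
Proof.
move=> e0 x0.
pose f (z : R * R) := expR (- (e * `|z.1|)) * cos (z.1 * z.2) * \1_`[0, x] z.2.
have mI : measurable_fun [set: R] (\1_`[0, x] : R -> R) by exact: measurable_indic.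
have mf : measurable_fun setT f.
  by rewrite /f; mfun; apply: (measurableT_comp mI); exact: measurable_snd.
have mf' : @measurable_fun _ _ (measurableTypeR R * measurableTypeR R)%type _ setT f := mf.
have i2 : Rintegrable mu (\1_`[0, x] : R -> R) by exact: integrable_indic_itv.
have fb s u : `|f (s, u)| <= expR (- (e * `|s|)) * \1_`[0, x] u.
  rewrite /f/= 2!normrM ger0_norm ?expR_ge0// (ger0_norm (x := \1_ _ _)) ?ler0n//.
  by rewrite ler_wpM2r ?ler0n// ler_piMr ?expR_ge0// cos_max.
have := Rfubini mf' (Rintegrable_laplace e0) i2 fb.
have E1 s : s != 0 -> \int[mu]_u f (s, u) = expR (- (e * `|s|)) * (sin (s * x) / s).
  move=> s0; transitivity (\int[mu]_u ((expR (- (e * `|s|)) * cos (s * u)) * \1_`[0, x] u)) => //.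
  have cf : continuous (fun u => expR (- (e * `|s|)) * cos (s * u)).
    move=> u; apply: cvgM; first exact: cvg_cst.
    apply: (@continuous_comp _ _ _ (fun u : R => s * u) cos); last exact: continuous_cos.
    by apply: cvgM; [exact: cvg_cst|exact: cvg_id].
  have dF (u : R) : is_derive u 1 (fun u => expR (- (e * `|s|)) * (sin (s * u) / s))
      (expR (- (e * `|s|)) * cos (s * u)).
    by apply: is_derive_eq; rewrite /GRing.scale/=; field.
  by rewrite (Rintegral_indic_primitive x0 cf dF) mulr0 sin0 mul0r mulr0 subr0.
have E2 u : \int[mu]_s f (s, u) = 2 * e / (e ^+ 2 + u ^+ 2) * \1_`[0, x] u.
  rewrite -Rintegral_laplace_cos// -RintegralZr//.
  apply: (Rintegrable_le _ _ (Rintegrable_laplace e0)); first by mfun.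
  by move=> s; rewrite normrM ger0_norm ?expR_ge0// ler_piMr ?expR_ge0// cos_max.
rewrite (Rintegral_punctured _ _ E1); last 2 first.
- exact: (Rintegrable_measurable (Rintegrable_fubini mf' (Rintegrable_laplace e0) i2 fb)).
- by mfun.
move=> ->; under eq_Rintegral do rewrite E2.
have d0 u : e ^+ 2 + u ^+ 2 != 0 by rewrite gt_eqF// ltr_wpDr ?sqr_ge0// exprn_gt0.
have cf : continuous (fun u : R => 2 * e / (e ^+ 2 + u ^+ 2)).
  move=> u; apply: cvgM; first exact: cvg_cst.
  by apply: cvgV => //; apply: cvgD; [exact: cvg_cst|exact: exprn_continuous].
have dF (u : R) : is_derive u 1 (fun u : R => 2 * atan (u / e)) (2 * e / (e ^+ 2 + u ^+ 2)).
  apply: is_derive_eq; rewrite /GRing.scale/=.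
  have e1 := lt0r_neq0 e0; have := d0 u => d1.
  rewrite (_ : 1 + (u / e) ^+ 2 = (e ^+ 2 + u ^+ 2) / e ^+ 2); last by field.
  by field; exact/andP.
by rewrite (Rintegral_indic_primitive x0 cf dF) mul0r atan0 mulr0 subr0.
Qed.

End calculus.

(** * Sign of a random variable by Fourier inversion *)

Section inversion.
Variable R : realType.
Notation mu := (@lebesgue_measure R).
Implicit Types e x : R.

Lemma Rintegral_laplace_sin e x : 0 < e ->
  \int[mu]_s (expR (- (e * `|s|)) * (sin (s * x) / s)) = 2 * atan (x / e).
Proof.
move=> e0; have [x0|x0] := leP 0 x; first exact: Rintegral_laplace_sin_ge0.
have x0' : 0 <= - x by rewrite oppr_ge0 ltW.
have := Rintegral_laplace_sin_ge0 e0 x0'.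
rewrite mulNr atanN mulrN => /(congr1 -%R); rewrite opprK => <-.
have i : Rintegrable mu (fun s : R => expR (- (e * `|s|)) * (sin (s * - x) / s)).
  apply: (Rintegrable_le _ _ (RintegrableZr `|x| (Rintegrable_laplace e0))); first by mfun.
  move=> s; rewrite normrM ger0_norm ?expR_ge0// ler_wpM2l ?expR_ge0// normrM normfV.
  have [->|s0] := eqVneq s 0; first by rewrite normr0 invr0 mulr0.
  by rewrite ler_pdivrMr ?normr_gt0// (le_trans (norm_sin_le _))// mulrN normrN normrM mulrC.
rewrite -mulN1r -RintegralZl//; apply: eq_Rintegral => s _.
by rewrite mulrN sinN; ring.
Qed.

(** The arctangent saturates at plus or minus pi / 2 when its argument is blown up, and it stays 0
    at 0, in agreement with [sgr0]. This is the limit of the regularized Dirichlet integral as [e]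
    tends to 0. *)
Lemma cvg_atan_sgr x : 2 * atan (x / n.+1%:R^-1) @[n --> \oo] --> pi * Num.sg x.
Proof.
have pos y : 0 < y -> 2 * atan (y / n.+1%:R^-1) @[n --> \oo] --> (pi : R).
  move=> y0; rewrite -[X in _ --> X](_ : 2 * (pi / 2) = pi); last by field.
  apply: cvgM; first exact: cvg_cst.
  apply: (cvg_comp (fun n => y / n.+1%:R^-1) atan); last exact: cvgy_atan.
  under eq_fun do rewrite invrK.
  apply: (cvg_comp (fun n => n.+1%:R : R) (fun z => y * z)).
    by have := @cvgr_idn R; rewrite -cvg_shiftS; apply: cvg_trans.
  exact: gt0_cvgMry.
have [x0|x0|->] := ltrgt0P x.
- by rewrite gtr0_sg// mulr1; exact: pos.
- rewrite ltr0_sg// mulrN1 -[x]opprK.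
  under eq_fun do rewrite mulNr atanN mulrN.
  by apply: cvgN; apply: pos; rewrite oppr_gt0.
- rewrite sgr0 mulr0; under eq_fun do rewrite mul0r atan0 mulr0.
  exact: cvg_cst.
Qed.

Lemma norm_sin_div_le x s : `|sin (s * x) / s| <= `|x|.
Proof.
rewrite normrM normfV.
have [->|s0] := eqVneq s 0; first by rewrite normr0 invr0 mulr0.
by rewrite ler_pdivrMr ?normr_gt0// (le_trans (norm_sin_le _))// normrM mulrC.
Qed.

Context d (T : measurableType d) (P : probability T R).

(* Dirichlet's [sg x = (1 / pi) \int_R sin (s x) / s ds], regularized by the factor [exp (- e |s|)]. *)
Lemma Rintegral_sgr_inversion (X W : T -> R) :
  measurable_fun setT X -> Rintegrable P W -> Rintegrable P (fun t => X t * W t) ->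
  Rintegrable mu (fun s => (\int[P]_t (sin (s * X t) * W t)) / s) ->
  \int[P]_t (Num.sg (X t) * W t) =
  pi^-1 * \int[mu]_s ((\int[P]_t (sin (s * X t) * W t)) / s).
Proof.
move=> mX iW iXW iS; have mW := Rintegrable_measurable iW.
have isin s : Rintegrable P (fun t => sin (s * X t) * W t).
  apply: (Rintegrable_le _ _ (Rintegrable_norm iW)); first by mfun.
  by move=> t; rewrite normrM ler_piMl// sin_max.
(* At fixed [e] Fubini applies: since |sin(s x)/s| <= |x|, the integrand is bounded by |X W| exp(-e
   |s|), a product of integrable functions. *)
have E e : 0 < e -> \int[P]_t (2 * atan (X t / e) * W t) =
    \int[mu]_s (expR (- (e * `|s|)) * ((\int[P]_t (sin (s * X t) * W t)) / s)).
  move=> e0.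
  pose f (z : T * R) := expR (- (e * `|z.2|)) * (sin (z.2 * X z.1) / z.2) * W z.1.
  have mf : measurable_fun setT f.
    have mX1 : measurable_fun setT (fun z : T * R => X z.1) by exact: (measurableT_comp mX).
    have mW1 : measurable_fun setT (fun z : T * R => W z.1) by exact: (measurableT_comp mW).
    by rewrite /f; mfun.
  have mf' : @measurable_fun _ _ (T * measurableTypeR R)%type _ setT f := mf.
  have := Rfubini mf' (Rintegrable_norm iXW) (Rintegrable_laplace e0).
  have fb t s : `|f (t, s)| <= `|X t * W t| * expR (- (e * `|s|)).
    rewrite /f/= 2!normrM ger0_norm ?expR_ge0// -mulrA mulrC ler_wpM2r ?expR_ge0//.
    by rewrite [leRHS]normrM ler_wpM2r// norm_sin_div_le.
  move=> /(_ fb).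
  under eq_Rintegral => t _.
    rewrite /f/= RintegralZr// ?Rintegral_laplace_sin//; last first.
      apply: (Rintegrable_le _ _ (RintegrableZr `|X t| (Rintegrable_laplace e0))); first by mfun.
      move=> s; rewrite normrM ger0_norm ?expR_ge0// ler_wpM2l ?expR_ge0//.
      exact: norm_sin_div_le.
    over.
  move=> ->; apply: eq_Rintegral => s _.
  rewrite mulrA mulrAC -RintegralZl//; last exact: isin.
  apply: eq_Rintegral => t _.
  by rewrite /f/=; ring.
have e0 n : (0 : R) < n.+1%:R^-1 by rewrite invr_gt0.
(* Now [e] runs through 1/(n+1). The left side of [E] converges with majorant pi |W|. *)
have L : \int[P]_t (2 * atan (X t / n.+1%:R^-1) * W t) @[n --> \oo] -->
    \int[P]_t (pi * Num.sg (X t) * W t).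
  apply: (proj2 (Rintegral_dominated (g := fun t => pi * `|W t|) _ _ _ _)).
  - by move=> n; mfun.
  - by move=> t; apply: cvgM; [exact: cvg_atan_sgr|exact: cvg_cst].
  - exact: RintegrableZl (Rintegrable_norm iW).
  - move=> n t; rewrite normrM ler_wpM2r// normrM ger0_norm// -ler_pdivlMl//.
    by rewrite [leRHS]mulrC ler_norml (ltW (atan_gtNpi2 _)) (ltW (atan_ltpi2 _)).
pose G s := (\int[P]_t (sin (s * X t) * W t)) / s.
(* The right side converges with majorant |G|, integrable by the hypothesis [iS]. *)
have L' : \int[mu]_s (expR (- (n.+1%:R^-1 * `|s|)) * G s) @[n --> \oo] --> \int[mu]_s G s.
  apply: (proj2 (Rintegral_dominated (mu := mu) (g := fun s => `|G s|) _ _ _ _)).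
  - by move=> n; apply: measurable_funM; [mfun|exact: (Rintegrable_measurable iS)].
  - move=> s; rewrite -[X in _ --> X]mul1r; apply: cvgM; last exact: cvg_cst.
    rewrite -[X in _ --> X]expR0; apply: (@continuous_cvg _ _ _ _ _ (fun n : nat => - (n.+1%:R^-1 * `|s|)) expR).
      exact: continuous_expR.
    rewrite -oppr0 -(mul0r `|s|); apply: cvgN.
    by apply: cvgM; [exact: cvg_harmonic|exact: cvg_cst].
  - exact: Rintegrable_norm iS.
  - by move=> n s; rewrite normrM ler_piMl// ger0_norm ?expR_ge0// -[leRHS]expR0 ler_expR oppr_le0 mulr_ge0.
have := cvg_lim (@Rhausdorff R) L; rewrite (_ : (fun n => _) =
  (fun n => \int[mu]_s (expR (- (n.+1%:R^-1 * `|s|)) * G s))); last first.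
  by apply/funext => n; exact: E.
rewrite (cvg_lim (@Rhausdorff R) L') => LE.
have isg : Rintegrable P (fun t => Num.sg (X t) * W t).
  apply: (Rintegrable_le _ _ (Rintegrable_norm iW)); first by mfun.
  by move=> t; rewrite normrM ler_piMl// normr_sg lern1 leq_b1.
apply: (mulfI (x := pi)); first by rewrite gt_eqF ?pi_gt0.
rewrite mulVKf ?gt_eqF ?pi_gt0// LE -RintegralZl//.
by apply: eq_Rintegral => t _; rewrite mulrA.
Qed.

End inversion.

(** * Gaussian integrals with hyperbolic functions *)

Section gaussian_integrals.
Variable R : realType.
Notation mu := (@lebesgue_measure R).
Implicit Types (x t s : R) (sigma tau kappa theta : R).

Definition cosh x : R := (expR x + expR (- x)) / 2.
Definition sinh x : R := (expR x - expR (- x)) / 2.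

Lemma cosh_gt0 x : 0 < cosh x.
Proof. by rewrite divr_gt0// addr_gt0 ?expR_gt0. Qed.

Lemma coshN x : cosh (- x) = cosh x.
Proof. by rewrite /cosh opprK addrC. Qed.

Lemma sinhN x : sinh (- x) = - sinh x.
Proof. by rewrite /sinh opprK -mulNr opprB. Qed.

Lemma sinh0 : sinh 0 = 0.
Proof. by rewrite /sinh oppr0 subrr mul0r. Qed.

Lemma expR_norm_le_cosh x : expR `|x| <= 2 * cosh x.
Proof.
rewrite /cosh mulrC divfK//; case: (leP 0 x) => x0.
  by rewrite ger0_norm// lerDl expR_ge0.
by rewrite ltr0_norm// lerDr expR_ge0.
Qed.

Lemma cosh_le_expR_norm x : cosh x <= expR `|x|.
Proof.
rewrite /cosh ler_pdivrMr// mulr_natr mulr2n lerD// ler_expR ?ler_norm//.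
by rewrite -normrN ler_norm.
Qed.

(** For [x >= 0], 1 - exp(-2x) <= 2x gives sinh x <= x exp(x) <= 2 x cosh x; oddness does the rest.
    The factor |x| tames sinh(kappa t)/t at 0. *)
Lemma norm_sinh_le x : `|sinh x| <= 2 * `|x| * cosh x.
Proof.
wlog x0 : x / 0 <= x => [H|].
  case: (leP 0 x) => x0; first exact: H.
  by rewrite -normrN -sinhN -coshN -(normrN x); apply: H; rewrite oppr_ge0 ltW.
have e1 : 1 <= expR x by rewrite -expR0 ler_expR.
have s0 : 0 <= sinh x by rewrite divr_ge0// subr_ge0 ler_expR; lra.
rewrite !ger0_norm//.
have H : sinh x <= x * expR x.
  rewrite /sinh ler_pdivrMr// lerBlDr.
  have : expR x * (1 + - (2 * x)) <= expR x * expR (- (2 * x)).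
    by rewrite ler_wpM2l ?expR_ge0// expR_ge1Dx.
  rewrite -expRD (_ : x + - (2 * x) = - x); last by ring.
  by lra.
apply: (le_trans H); rewrite mulrAC mulrC ler_wpM2r//.
by rewrite -{1}(ger0_norm x0) expR_norm_le_cosh.
Qed.

Lemma measurable_fun_cosh d (T : measurableType d) (f : T -> R) :
  measurable_fun setT f -> measurable_fun setT (fun z => cosh (f z)).
Proof. by move=> mf; rewrite /cosh; mfun. Qed.

Lemma measurable_fun_sinh d (T : measurableType d) (f : T -> R) :
  measurable_fun setT f -> measurable_fun setT (fun z => sinh (f z)).
Proof. by move=> mf; rewrite /sinh; mfun. Qed.

(** Characteristic function at [t] of a centred normal variable of standard deviation [tau]; as an
    unnormalized density in [t] its standard deviation is [tau^-1]. *)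
Definition gauss tau t : R := expR (- ((tau * t) ^+ 2 / 2)).

Lemma measurable_fun_gauss d (T : measurableType d) tau (f : T -> R) :
  measurable_fun setT f -> measurable_fun setT (fun z => gauss tau (f z)).
Proof. by move=> mf; rewrite /gauss; mfun. Qed.

Lemma gauss_ge0 tau t : 0 <= gauss tau t. Proof. exact: expR_ge0. Qed.

(** Completing the square exhibits a multiple of a normal density, so that the integral follows from
    its total mass 1. *)
Lemma gauss_expRE tau kappa t : 0 < tau ->
  gauss tau t * expR (kappa * t) =
  Num.sqrt (2 * pi) / tau * expR ((kappa / tau) ^+ 2 / 2) *
  normal_pdf (kappa / tau ^+ 2) tau^-1 t.
Proof.
move=> tau0; have t1 := lt0r_neq0 tau0.
rewrite normal_pdfE ?invr_eq0// /normal_peak /normal_fun.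
have -> : Num.sqrt (tau^-1 ^+ 2 * pi *+ 2) = Num.sqrt (2 * pi) / tau :> R.
  rewrite -mulrnAr -[pi *+ 2]mulr_natl sqrtrM ?sqr_ge0// sqrtr_sqr mulrC.
  by rewrite gtr0_norm ?invr_gt0.
have p0 : Num.sqrt (2 * pi) != 0 :> R.
  by rewrite gt_eqF// sqrtr_gt0 mulr_gt0// pi_gt0.
rewrite [RHS]mulrACA divff ?mul1r; last by rewrite mulf_neq0// invr_eq0.
by rewrite -!expRD; congr expR; field.
Qed.

Lemma gauss_expR tau kappa : 0 < tau ->
  Rintegrable mu (fun t => gauss tau t * expR (kappa * t)) /\
  \int[mu]_t (gauss tau t * expR (kappa * t)) =
  Num.sqrt (2 * pi) / tau * expR ((kappa / tau) ^+ 2 / 2).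
Proof.
move=> tau0; under eq_fun do rewrite gauss_expRE//.
have i : Rintegrable mu (normal_pdf (kappa / tau ^+ 2) tau^-1).
  exact: integrable_normal_pdf.
split; first exact: RintegrableZl.
by rewrite RintegralZl// [X in _ * X]/Rintegral integral_normal_pdf mulr1.
Qed.

Lemma gauss_coshE tau kappa t : gauss tau t * cosh (kappa * t) =
  2^-1 * (gauss tau t * expR (kappa * t) + gauss tau t * expR (- kappa * t)).
Proof. by rewrite /cosh mulNr; field. Qed.

Lemma gauss_cosh tau kappa : 0 < tau ->
  Rintegrable mu (fun t => gauss tau t * cosh (kappa * t)) /\
  \int[mu]_t (gauss tau t * cosh (kappa * t)) =
  Num.sqrt (2 * pi) / tau * expR ((kappa / tau) ^+ 2 / 2).
Proof.
move=> tau0; have [i1 E1] := gauss_expR kappa tau0.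
have [i2 E2] := gauss_expR (- kappa) tau0.
under eq_fun do rewrite gauss_coshE.
split; first by apply: RintegrableZl; exact: RintegrableD.
rewrite RintegralZl//; last exact: RintegrableD.
by rewrite RintegralD// E1 E2 mulNr sqrrN; field; rewrite gt_eqF.
Qed.

Lemma gauss_integral tau : 0 < tau ->
  Rintegrable mu (gauss tau) /\ \int[mu]_t gauss tau t = Num.sqrt (2 * pi) / tau.
Proof.
move=> tau0; have [i E] := gauss_expR 0 tau0.
have e : (fun t => gauss tau t * expR (0 * t)) = gauss tau.
  by apply/funext => t; rewrite mul0r expR0 mulr1.
by move: i E; rewrite e mul0r expr0n/= mul0r expR0 mulr1.
Qed.

Lemma Rintegrable_gauss_sinh tau kappa : 0 < tau ->
  Rintegrable mu (fun t => gauss tau t * (sinh (kappa * t) / t)).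
Proof.
move=> tau0; have [i _] := gauss_cosh kappa tau0.
apply: (Rintegrable_le _ _ (RintegrableZl (2 * `|kappa|) i)).
  apply: measurable_funM; first exact: measurable_fun_gauss.
  by apply: measurable_funM; [apply: measurable_fun_sinh; mfun|mfun].
move=> t; rewrite normrM (ger0_norm (gauss_ge0 _ _)) mulrCA ler_wpM2l ?gauss_ge0//.
rewrite normrM normfV; have [->|t0] := eqVneq t 0.
  by rewrite normr0 invr0 mulr0 !mulr_ge0// ltW ?cosh_gt0.
rewrite ler_pdivrMr ?normr_gt0// (le_trans (norm_sinh_le _))// normrM.
by rewrite le_eqVlt; apply/orP; left; apply/eqP; ring.
Qed.

End gaussian_integrals.

(** * The double Gaussian integral behind the arcsine law *)

Section orthant_integral.
Variable R : realType.
Notation mu := (@lebesgue_measure R).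
Implicit Types (x t s r : R) (sigma tau kappa theta : R).

Lemma continuous_comp_expR (f : R -> R) : continuous f -> continuous (fun x : R => expR (f x)).
Proof.
by move=> cf x; apply: (@continuous_comp _ _ _ f expR); [exact: cf|exact: continuous_expR].
Qed.

(** Moving the coefficient [r * sin x] from 0 to its final value along the angle [x] trades the
    division by [t] for an integral over the angle. *)
Lemma sinh_sin_primitive r t theta : t != 0 -> 0 <= theta ->
  \int[mu]_x (r * cos x * cosh (r * sin x * t) * \1_`[0, theta] x) = sinh (r * sin theta * t) / t.
Proof.
move=> t0 th0.
have cf : continuous (fun x : R => r * cos x * cosh (r * sin x * t)).
  have cl : continuous (fun x : R => r * sin x * t).
    by move=> x; apply: cvgM; [apply: cvgM; [exact: cvg_cst|exact: continuous_sin]|exact: cvg_cst].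
  move=> x; apply: cvgM; first by apply: cvgM; [exact: cvg_cst|exact: continuous_cos].
  apply: cvgM; last exact: cvg_cst.
  have cNl : continuous (fun x : R => - (r * sin x * t)) by move=> y; apply: cvgN; exact: cl.
  by apply: cvgD; [exact: (continuous_comp_expR cl)|exact: (continuous_comp_expR cNl)].
have dF (x : R) : is_derive x 1 (fun x : R => sinh (r * sin x * t) / t)
    (r * cos x * cosh (r * sin x * t)).
  rewrite /sinh /cosh; apply: is_derive_eq; rewrite /GRing.scale/=.
  by field.
by rewrite (Rintegral_indic_primitive th0 cf dF) sin0 mulr0 mul0r sinh0 mul0r subr0.
Qed.

(** Insert the angular integral of [sinh_sin_primitive] and exchange; for each angle the
    [t]-integral is [gauss_cosh] with coefficient [r * sin x]. *)
Lemma gauss_sinh_sin tau r theta : 0 < tau -> 0 <= theta ->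
  \int[mu]_t (gauss tau t * (sinh (r * sin theta * t) / t)) =
  \int[mu]_x (r * cos x * (Num.sqrt (2 * pi) / tau * expR ((r * sin x / tau) ^+ 2 / 2))
              * \1_`[0, theta] x).
Proof.
move=> tau0 th0.
pose f (z : R * R) := gauss tau z.1 * (r * cos z.2 * cosh (r * sin z.2 * z.1)) * \1_`[0, theta] z.2.
have mI : measurable_fun [set: R] (\1_`[0, theta] : R -> R) by exact: measurable_indic.
have mf : measurable_fun setT f.
  rewrite /f; apply: measurable_funM; last by apply: (measurableT_comp mI); exact: measurable_snd.
  apply: measurable_funM; first by apply: measurable_fun_gauss; mfun.
  by apply: measurable_funM; [mfun|apply: measurable_fun_cosh; mfun].
have mf' : @measurable_fun _ _ (measurableTypeR R * measurableTypeR R)%type _ setT f := mf.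
have [ig _] := gauss_cosh r tau0.
have i1 : Rintegrable mu (fun t => 2 * `|r| * (gauss tau t * cosh (r * t))) by exact: RintegrableZl.
have i2 : Rintegrable mu (\1_`[0, theta] : R -> R) by exact: integrable_indic_itv.
have cB t x : `|r * cos x * cosh (r * sin x * t)| <= 2 * `|r| * cosh (r * t).
  rewrite 2!normrM (ger0_norm (ltW (cosh_gt0 _))) [leRHS]mulrAC [leRHS]mulrC ler_pM//.
  - by rewrite ltW ?cosh_gt0.
  - by rewrite ler_piMr// cos_max.
  - apply: (le_trans (cosh_le_expR_norm _)); apply: le_trans (expR_norm_le_cosh _).
    by rewrite ler_expR mulrAC normrM ler_piMr// sin_max.
have fb t x : `|f (t, x)| <= 2 * `|r| * (gauss tau t * cosh (r * t)) * \1_`[0, theta] x.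
  rewrite /f/= normrM (ger0_norm (x := \1_ _ _)) ?ler0n// ler_wpM2r ?ler0n//.
  rewrite normrM (ger0_norm (gauss_ge0 _ _)) [leRHS]mulrCA ler_wpM2l ?gauss_ge0//.
have := Rfubini mf' i1 i2 fb.
have E1 t : t != 0 -> \int[mu]_x f (t, x) = gauss tau t * (sinh (r * sin theta * t) / t).
  move=> t0; rewrite -sinh_sin_primitive// -RintegralZl//.
    by apply: eq_Rintegral => x _; rewrite /f/=; ring.
  apply: (Rintegrable_le _ _ (RintegrableZl (2 * `|r| * cosh (r * t)) i2)).
    apply: measurable_funM => //; apply: measurable_funM; first by mfun.
    by apply: measurable_fun_cosh; mfun.
  by move=> x; rewrite normrM (ger0_norm (x := \1_ _ _)) ?ler0n// ler_wpM2r ?ler0n// cB.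
have E2 x : \int[mu]_t f (t, x) = r * cos x *
    (Num.sqrt (2 * pi) / tau * expR ((r * sin x / tau) ^+ 2 / 2)) * \1_`[0, theta] x.
  have [ig' <-] := gauss_cosh (r * sin x) tau0.
  rewrite -RintegralZl// -RintegralZr//; last exact: RintegrableZl.
  by apply: eq_Rintegral => t _; rewrite /f/=; ring.
rewrite (Rintegral_punctured _ _ E1); last 2 first.
- exact: (Rintegrable_measurable (Rintegrable_fubini mf' i1 i2 fb)).
- exact: (Rintegrable_measurable (Rintegrable_gauss_sinh _ tau0)).
by move=> ->; under eq_Rintegral do rewrite E2.
Qed.

(** Because 1 - sin^2 = cos^2, the exponential produced by the [t]-integral only rescales the
    Gaussian in [s]; integrating it over [s] yields 1/(sigma cos x), which cancels the factor cos x
    of the angular integrand. *)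
Lemma gauss_mul_expR_sin sigma x s :
  gauss sigma s * expR ((sigma * s * sin x) ^+ 2 / 2) = gauss (sigma * cos x) s.
Proof.
by rewrite /gauss -expRD; congr expR; rewrite !exprMn cos2sin2; field.
Qed.

Lemma integral_punctured_at (c : R) (f g : R -> \bar R) :
  measurable_fun setT f -> measurable_fun setT g ->
  (forall x, x != c -> f x = g x) -> (\int[mu]_x f x = \int[mu]_x g x)%E.
Proof.
move=> mf mg fg; apply: ae_eq_integral => //.
exists [set c]; split => //; first exact: lebesgue_measure_set1.
move=> x /= h; apply: contrapT => /eqP x0; apply: h => _ /=.
by rewrite fg.
Qed.

(** Inner integral of exp(-(sigma^2 s^2 + tau^2 t^2)/2) sinh(kappa s t)/(s t) over [t]: up to
    constants, the Fourier form of E[sg(X) sg(Y)] for a Gaussian pair with standard deviations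
    [sigma], [tau] and covariance [kappa]. *)
Definition orthant_kernel sigma tau kappa s :=
  gauss sigma s * (\int[mu]_t (gauss tau t * (sinh (kappa * s * t) / t))) / s.

(* With [kappa = sigma tau sin theta], writing [sinh (kappa s t)] as an integral over the angle makes
   the double Gaussian integral equal to [2 pi] for every angle in [0, theta]. *)
Lemma integral_orthant_kernel_sin sigma tau theta : 0 < sigma -> 0 < tau -> 0 <= theta <= pi / 2 ->
  Rintegrable mu (orthant_kernel sigma tau (sigma * tau * sin theta)) /\
  \int[mu]_s orthant_kernel sigma tau (sigma * tau * sin theta) s = 2 * pi * theta.
Proof.
move=> sig0 tau0 /andP[th0 thpi].
(* What remains of sigma tau, from [kappa], and of sqrt(2 pi)/tau, from the [t]-integral. *)
pose c0 : R := Num.sqrt (2 * pi) * sigma.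
have c0_ge0 : 0 <= c0 by rewrite mulr_ge0// ltW.
pose k (z : R * R) := c0 * cos z.2 * gauss (sigma * cos z.2) z.1 * \1_`[0, theta] z.2.
have mI : measurable_fun [set: R] (\1_`[0, theta] : R -> R) by exact: measurable_indic.
have mk : measurable_fun setT k.
  rewrite /k; apply: measurable_funM; last by apply: (measurableT_comp mI); exact: measurable_snd.
  by rewrite /gauss; mfun.
have mk' : @measurable_fun _ _ (measurableTypeR R * measurableTypeR R)%type _ setT k := mk.
(* The angles lie in [0, pi/2], where the cosine is nonnegative, so Tonelli applies to [k]. *)
have k0 z : 0 <= k z.
  rewrite /k indicE; case: (boolP (_ \in _)); last by rewrite mulr0.
  rewrite inE/= in_itv/= => /andP[z0 zth]; rewrite mulr1 mulr_ge0 ?gauss_ge0// mulr_ge0//.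
  by apply: cos_ge0_pihalf; rewrite (le_trans zth)// andbT (le_trans _ z0)// oppr_le0 divr_ge0// pi_ge0.
have ik s : Rintegrable mu (fun x => k (s, x)).
  have i2 : Rintegrable mu (\1_`[0, theta] : R -> R) by exact: integrable_indic_itv.
  apply: (Rintegrable_le _ _ (RintegrableZl c0 i2)).
    exact: (measurable_fun_pair2 _ mk').
  move=> x; rewrite /k/= normrM (ger0_norm (x := \1_ _ _)) ?ler0n// ler_wpM2r ?ler0n//.
  rewrite normrM (ger0_norm (gauss_ge0 _ _)) normrM (ger0_norm c0_ge0) -mulrA ler_piMr//.
  rewrite mulr_ile1 ?gauss_ge0 ?cos_max// /gauss -expR0 ler_expR oppr_le0.
  by rewrite divr_ge0// sqr_ge0.
pose K s := \int[mu]_x k (s, x).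
have EK s : s != 0 -> orthant_kernel sigma tau (sigma * tau * sin theta) s = K s.
  move=> s0; rewrite /orthant_kernel.
  rewrite (_ : sigma * tau * sin theta * s = (sigma * tau * s) * sin theta); last by ring.
  rewrite gauss_sinh_sin// /K.
  have E x : k (s, x) = gauss sigma s / s * (sigma * tau * s * cos x *
      (Num.sqrt (2 * pi) / tau * expR ((sigma * tau * s * sin x / tau) ^+ 2 / 2)) * \1_`[0, theta] x).
    rewrite /k/= -gauss_mul_expR_sin.
    rewrite (_ : sigma * tau * s * sin x / tau = sigma * s * sin x); last by field; rewrite gt_eqF.
    by rewrite /c0; field; rewrite s0 gt_eqF.
  under [RHS]eq_Rintegral do rewrite E.
  rewrite RintegralZl//; first by rewrite mulrAC.
  have := RintegrableZl (gauss sigma s / s)^-1 (ik s); congr (Rintegrable _ _).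
  by apply/funext => x; rewrite E mulKf// mulf_neq0 ?invr_eq0// gt_eqF// expR_gt0.
have KE s : (K s)%:E = (\int[mu]_x (k (s, x))%:E)%E by rewrite (Rintegral_EFin (ik s)).
have mEk : @measurable_fun _ _ (measurableTypeR R * measurableTypeR R)%type _ setT (EFin \o k).
  exact/measurable_EFinP.
have k0' z : (0 <= (EFin \o k) z)%E by rewrite lee_fin.
have mK : @measurable_fun _ _ (measurableTypeR R) _ setT (EFin \o K).
  rewrite (_ : EFin \o K = fubini_F mu (EFin \o k)).
    exact: measurable_fun_fubini_tonelli_F.
  by apply/funext => s; rewrite /= KE.
(* At pi/2 the Gaussian in [s] degenerates to a constant. This single angle is null, so full
   correlation, theta = pi/2, is covered too. *)
have inner x : x != pi / 2 -> (\int[mu]_s (k (s, x))%:E = (2 * pi * \1_`[0, theta] x)%:E)%E.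
  move=> xpi; rewrite /k/= indicE; case: (boolP (x \in _)) => [|_].
    rewrite inE/= in_itv/= => /andP[x0 xth].
    have cx0 : 0 < cos x.
      apply: cos_gt0_pihalf; apply/andP; split; last by rewrite lt_neqAle xpi (le_trans xth thpi).
      by rewrite (lt_le_trans _ x0)// oppr_lt0 divr_gt0// pi_gt0.
    have [ig Eg] := gauss_integral (mulr_gt0 sig0 cx0).
    under eq_integral do rewrite mulr1.
    rewrite Rintegral_EFin; last exact: RintegrableZl.
    rewrite RintegralZl// Eg mulr1 /c0; congr EFin.
    transitivity (Num.sqrt (2 * pi) * Num.sqrt (2 * pi) : R).
      by field; rewrite !gt_eqF.
    by rewrite -expr2 sqr_sqrtr// mulr_ge0// pi_ge0.
  under eq_integral do rewrite mulr0.
  by rewrite mulr0 integral0.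
have total : (\int[mu]_s (K s)%:E = (2 * pi * theta)%:E)%E.
  under eq_integral do rewrite KE.
  have := @fubini_tonelli _ _ _ _ _ mu mu (EFin \o k) mEk k0'; rewrite /comp => ->.
  rewrite (integral_punctured_at _ _ inner).
  - rewrite Rintegral_EFin; last by apply: RintegrableZl; exact: integrable_indic_itv.
    have dF (x : R) : is_derive x 1 (fun x : R => 2 * pi * x) (2 * pi).
      have := is_deriveZ (2 * pi) (is_derive_id x (1 : R)).
      by rewrite /GRing.scale/= mulr1.
    by rewrite (Rintegral_indic_primitive th0 (@cst_continuous _ _ (2 * pi)) dF) mulr0 subr0.
  - exact: (@measurable_fun_fubini_tonelli_G _ _ _ _ _ mu (EFin \o k) mEk k0').
  - by apply/measurable_EFinP; apply: measurable_funM.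
have K0 s : 0 <= K s by apply: Rintegral_ge0 => x _; exact: k0.
have iK : Rintegrable mu K.
  apply/Rintegral_normE; first exact/measurable_EFinP.
  by under eq_integral do rewrite (ger0_norm (K0 _)); rewrite total ltry.
(* The factor [s * s^-1] is 1 off 0 and 0 at 0; the resulting identity holds everywhere and gives
   measurability and the majorant [K]. *)
have Eall s : orthant_kernel sigma tau (sigma * tau * sin theta) s = K s * (s * s^-1).
  have [->|s0] := eqVneq s 0; first by rewrite /orthant_kernel invr0 !mulr0.
  by rewrite EK// divff// mulr1.
have mo : measurable_fun setT (orthant_kernel sigma tau (sigma * tau * sin theta)).
  rewrite (_ : orthant_kernel _ _ _ = fun s => K s * (s * s^-1)); last exact/funext.
  by apply: measurable_funM; [exact: (Rintegrable_measurable iK)|mfun].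
split.
  apply: (Rintegrable_le (mu := mu) mo _ iK) => s; rewrite Eall normrM (ger0_norm (K0 s)) ler_piMr//.
  by have [->|s0] := eqVneq s 0; [rewrite mul0r normr0|rewrite divff// normr1].
rewrite (Rintegral_punctured mo (Rintegrable_measurable iK) EK).
by rewrite /Rintegral total.
Qed.

End orthant_integral.

(** * The double integral as an arcsine of the correlation *)

Section orthant_asin.
Variable R : realType.
Notation mu := (@lebesgue_measure R).
Implicit Types (x s : R) (sigma tau kappa : R).

Lemma asinN x : -1 <= x <= 1 -> asin (- x) = - asin x.
Proof.
move=> x1; have /andP[l u] := (asin_def x1).1.
rewrite -{1}(asin_def x1).2 -sinN sinK// in_itv/= lerN2 u/=.
by rewrite lerNl.
Qed.

Lemma asin_ge0 x : 0 <= x <= 1 -> 0 <= asin x.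
Proof.
move=> /andP[x0 x1]; have x1' : -1 <= x <= 1 by rewrite x1 andbT (le_trans _ x0).
rewrite leNgt; apply/negP => a0; have [/andP[l _] E] := asin_def x1'.
have : 0 < sin (- asin x).
  apply: sin_gt0_pi; rewrite oppr_gt0 a0/= ltrNl.
  by rewrite (lt_le_trans _ l)// ltrN2 ltr_pdivrMr// ltr_pMr ?pi_gt0// ltr1n.
by rewrite sinN E oppr_gt0 ltNge x0.
Qed.

Lemma orthant_kernelN sigma tau kappa s : 0 < tau ->
  orthant_kernel sigma tau (- kappa) s = - orthant_kernel sigma tau kappa s.
Proof.
move=> tau0; rewrite /orthant_kernel -mulNr -mulrN; congr (_ * _ / _).
rewrite -mulN1r -RintegralZl//; last exact: Rintegrable_gauss_sinh.
by apply: eq_Rintegral => t _; rewrite !mulNr sinhN; ring.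
Qed.

(** For [kappa >= 0] take the angle theta = asin(kappa/(sigma tau)); both sides are odd in
    [kappa]. *)
Lemma integral_orthant_kernel sigma tau kappa : 0 < sigma -> 0 < tau -> `|kappa| <= sigma * tau ->
  Rintegrable mu (orthant_kernel sigma tau kappa) /\
  \int[mu]_s orthant_kernel sigma tau kappa s = 2 * pi * asin (kappa / (sigma * tau)).
Proof.
move=> sig0 tau0; have st0 : 0 < sigma * tau by rewrite mulr_gt0.
have pos kap : 0 <= kap -> kap <= sigma * tau ->
  Rintegrable mu (orthant_kernel sigma tau kap) /\
  \int[mu]_s orthant_kernel sigma tau kap s = 2 * pi * asin (kap / (sigma * tau)).
  move=> k0 kle; have q : 0 <= kap / (sigma * tau) <= 1.
    by rewrite divr_ge0 ?(ltW st0)//= ler_pdivrMr// mul1r.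
  have q' : -1 <= kap / (sigma * tau) <= 1.
    by case/andP: q => q0 ->; rewrite andbT (le_trans _ q0).
  have := @integral_orthant_kernel_sin _ sigma tau (asin (kap / (sigma * tau))) sig0 tau0.
  rewrite asinK ?in_itv//= [sigma * tau * (kap / _)]mulrC divfK ?gt_eqF//; apply.
  by rewrite asin_ge0//= asin_lepi2.
case: (leP 0 kappa) => k0; first by rewrite ger0_norm//; exact: pos.
rewrite ltr0_norm// => kle; have k0' : 0 <= - kappa by rewrite oppr_ge0 ltW.
have [i E] := pos _ k0' kle.
have EN : (fun s => -1 * orthant_kernel sigma tau (- kappa) s) = orthant_kernel sigma tau kappa.
  by apply/funext => s; rewrite orthant_kernelN// mulN1r opprK.
rewrite -EN; split; first exact: RintegrableZl.
rewrite RintegralZl// E [- kappa / _]mulNr asinN; first by ring.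
apply/andP; split; last by rewrite ler_pdivrMr// mul1r (le_trans (ltW k0)) ?ltW.
by rewrite ler_pdivlMr// mulN1r lerNl.
Qed.

End orthant_asin.

(** * Second moments from the characteristic function *)

Section difference_quotient.
Variable R : realType.

Lemma cvg_difference_quotient (F : R -> R) (l : R) (h : nat -> R) :
  is_derive (0 : R) 1 F l -> h n @[n --> \oo] --> 0 -> (forall n, h n != 0) ->
  (h n)^-1 * (F (h n) - F 0) @[n --> \oo] --> l.
Proof.
move=> [dF <-] h0 hN0.
have /cvg_ex[/= y yE] := dF.
have E := cvg_lim (@Rhausdorff R) yE; rewrite /derive E.
have H : h n @[n --> \oo] --> (0 : R)^'.
  move=> A HA; have HA' : \forall n \near \oo, (h n != 0 -> A (h n)) := h0 _ HA.
  by change (\forall n \near \oo, A (h n)); apply: filterS HA' => n; apply.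
have := cvg_comp _ _ H yE.
apply: cvg_trans; apply: near_eq_cvg; apply: nearW => n /=.
by rewrite /GRing.scale/= mulr1 addr0.
Qed.

Lemma cvg_harmonic0 : (n.+1%:R^-1 : R) @[n --> \oo] --> 0.
Proof. exact: cvg_harmonic. Qed.

Lemma cvg_finsum (I : finType) (u : I -> nat -> R) (l : I -> R) :
  (forall i, u i n @[n --> \oo] --> l i) -> \sum_i u i n @[n --> \oo] --> \sum_i l i.
Proof.
by move=> ul; apply: cvg_big => [|i _]; [exact: add_continuous|exact: ul].
Qed.

Context d (T : measurableType d) (P : probability T R).
Variables (K : nat) (p : 'I_K -> R).
Hypothesis p0 : forall k, 0 <= p k.

(** The second differences 2 (1 - cos(h X))/h^2 lie between 0 and X^2 and tend to X^2 as h tends to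
    0, while their expectations are known. Fatou's lemma gives integrability of X^2, after which X^2
    itself is the majorant for dominated convergence. *)
Lemma mixture_second_moment (X : T -> R) (a : 'I_K -> R) :
  measurable_fun setT X -> (forall k, 0 <= a k) ->
  (forall s, \int[P]_t cos (s * X t) = \sum_k p k * expR (- (a k * s ^+ 2 / 2))) ->
  \sum_k p k = 1 ->
  Rintegrable P (fun t => X t ^+ 2) /\ \int[P]_t (X t ^+ 2) = \sum_k p k * a k.
Proof.
move=> mX a0 cf p1.
have h0 n : 0 < n.+1%:R^-1 :> R by rewrite invr_gt0.
pose f n t := 2 * n.+1%:R ^+ 2 * (1 - cos (n.+1%:R^-1 * X t)) : R.
have fE n t : f n t = (n.+1%:R * sin (n.+1%:R^-1 * (X t / 2)) * 2) ^+ 2.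
  rewrite /f (_ : n.+1%:R^-1 * X t = (n.+1%:R^-1 * (X t / 2)) *+ 2); last first.
    by rewrite -mulr_natr; field.
  by rewrite cos_mulr2n cos2sin2; ring.
have mf n : measurable_fun setT (f n) by rewrite /f; mfun.
have f0 n t : 0 <= f n t by rewrite fE sqr_ge0.
have f_le n t : f n t <= X t ^+ 2.
  rewrite fE -[leLHS]real_normK ?num_real// -[leRHS]real_normK ?num_real//.
  rewrite lerXn2r ?nnegrE// normrM normrM ger0_norm// (ger0_norm (x := 2))//.
  have H := norm_sin_le (n.+1%:R^-1 * (X t / 2)).
  rewrite !normrM (ger0_norm (ltW (h0 n))) (ger0_norm (x := 2^-1))// in H.
  rewrite -ler_pdivlMr// -ler_pdivlMl//.
have f_cvg t : f n t @[n --> \oo] --> X t ^+ 2.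
  under eq_fun do rewrite fE.
  have dF : is_derive (0 : R) 1 (fun h => sin (h * (X t / 2))) (X t / 2).
    by apply: is_derive_eq; rewrite mul0r cos0 /GRing.scale/=; ring.
  have := cvg_difference_quotient dF cvg_harmonic0 (fun n => lt0r_neq0 (h0 n)).
  under eq_fun do rewrite mul0r sin0 subr0 invrK.
  move=> /cvgM /(_ (@cvg_cst _ (2 : R) _ _ _)); rewrite divfK// => H.
  exact: (cvg_comp _ _ H (@exprn_continuous R 2 (X t))).
have icos n : Rintegrable P (fun t => cos (n.+1%:R^-1 * X t)).
  by apply: (Rintegrable_bounded P (M := 1)) => [|t]; [mfun|exact: cos_max].
have i1 : Rintegrable P (cst 1).
  by apply: (Rintegrable_bounded P (M := 1)) => // t; rewrite normr1.
have If n : \int[P]_t f n t = \sum_k p k * (2 * n.+1%:R ^+ 2 * (1 - expR (- (a k * n.+1%:R^-1 ^+ 2 / 2)))).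
  rewrite /f RintegralZl//; last exact: RintegrableB.
  rewrite (RintegralB measurableT i1 (icos n)) cf.
  have -> : \int[P]_t cst (1 : R) t = 1.
    rewrite /Rintegral/= integral_cst//. by have := probability_setT P => /= ->; rewrite mule1.
  rewrite -[X in X - _]p1 -sumrB mulr_sumr.
  by apply: eq_bigr => k _; ring.
have fi n : Rintegrable P (f n) by apply: RintegrableZl; exact: RintegrableB.
have lim_f : \int[P]_t f n t @[n --> \oo] --> \sum_k p k * a k.
  under eq_fun do rewrite If; apply: cvg_finsum => k; apply: cvgM; first exact: cvg_cst.
  (* The expectation is a first-order difference quotient in the variable h^2, so its limit is a
     derivative at 0. *)
  have dF : is_derive (0 : R) 1 (fun h => - 2 * expR (- (a k * h / 2))) (a k).
    by apply: is_derive_eq; rewrite mulr0 mul0r oppr0 expR0 /GRing.scale/=; field.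
  have h2 : (n.+1%:R^-1 ^+ 2 : R) @[n --> \oo] --> 0.
    rewrite (_ : 0 = 0 ^+ 2 :> R); last by rewrite expr0n.
    by apply: (cvg_comp _ (fun x => x ^+ 2) cvg_harmonic0); exact: exprn_continuous.
  have := cvg_difference_quotient dF h2 (fun n => lt0r_neq0 (exprn_gt0 2 (h0 n))).
  apply: cvg_trans; apply: near_eq_cvg; apply: nearW => n /=.
  by rewrite mulr0 mul0r oppr0 expR0; field.
have X2i : Rintegrable P (fun t => X t ^+ 2).
  apply/Rintegral_normE; first by mfun.
  apply: (@le_lt_trans _ _ (\sum_k p k * a k)%:E); last exact: ltry.
  under eq_integral => t _ do rewrite (ger0_norm (sqr_ge0 (X t))).
  have -> : (\int[P]_t (X t ^+ 2)%:E = \int[P]_t (limn_einf (fun n => (f n t)%:E)))%E.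
    apply: eq_integral => t _; apply/esym.
    have H : (f n t)%:E @[n --> \oo] --> (X t ^+ 2)%:E by apply: cvg_EFin; [exact: nearW|exact: f_cvg].
    by rewrite is_cvg_limn_einfE; [exact: cvg_lim|apply/cvg_ex; exists (X t ^+ 2)%:E].
  apply: (le_trans (fatou P measurableT (f := fun n t => (f n t)%:E) _ _)).
  - by move=> n; exact/measurable_EFinP.
  - by move=> n t _; rewrite lee_fin.
  - under eq_fun do rewrite Rintegral_EFin//.
    have H : (\int[P]_t f n t)%:E @[n --> \oo] --> (\sum_k p k * a k)%:E.
      by apply: cvg_EFin; [exact: nearW|exact: lim_f].
    rewrite is_cvg_limn_einfE; last by apply/cvg_ex; exists (\sum_k p k * a k)%:E.
    by rewrite (cvg_lim _ H).
split => //.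
have [_ L] := Rintegral_dominated mf f_cvg X2i (fun n t => ltac:(rewrite ger0_norm//)).
by rewrite -(cvg_lim (@Rhausdorff R) L) (cvg_lim (@Rhausdorff R) lim_f).
Qed.

End difference_quotient.

(** * Pairs with a Gaussian mixture characteristic function *)

Section mixture.
Context (R : realType) d (T : measurableType d) (P : probability T R).
Notation mu := (@lebesgue_measure R).
Variables (K : nat) (p : 'I_K -> R).
Hypothesis p1 : \sum_k p k = 1.

(** The real part of the joint characteristic function; [a k], [b k] and [c k] are the variances and
    the covariance under component [k]. *)
Definition mixture_cf (X Y : T -> R) (a b c : 'I_K -> R) := forall s t : R,
  \int[P]_w cos (s * X w + t * Y w) =
  \sum_k p k * expR (- ((a k * s ^+ 2 + 2 * c k * s * t + b k * t ^+ 2) / 2)).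

Definition psd_form (a b c : R) := forall s t : R, 0 <= a * s ^+ 2 + 2 * c * s * t + b * t ^+ 2.

(** The last bound is the Cauchy-Schwarz inequality; it keeps correlations in the domain [-1, 1] of
    [asin]. *)
Lemma psd_form_ge0 a b c : psd_form a b c -> [/\ 0 <= a, 0 <= b & `|c| <= Num.sqrt a * Num.sqrt b].
Proof.
move=> q.
have a0 : 0 <= a by have := q 1 0; rewrite expr1n expr0n/= !mulr0 !addr0 mulr1.
have b0 : 0 <= b by have := q 0 1; rewrite expr1n expr0n/= !mulr0 mul0r !add0r mulr1.
split => //; rewrite -sqrtrM// -sqrtr_sqr ler_sqrt ?mulr_ge0//.
have [b0'|b0'] := eqVneq b 0.
  have [->|c0] := eqVneq c 0; first by rewrite expr0n/= mulr_ge0.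
  (* For [b = 0] the form is affine in [t], and this [t] gives it the value -1. *)
  have := q 1 (- (a + 1) / (2 * c)); rewrite b0' => H; exfalso; move: H.
  rewrite (_ : _ + _ = - 1); last by field.
  by rewrite ler0N1.
have bp : 0 < b by rewrite lt_neqAle eq_sym b0' b0.
(* The minimizer in [t] at [s = 1]. *)
have := q 1 (- (c / b)); rewrite (_ : _ + _ = (a * b - c ^+ 2) / b); last by field.
by rewrite pmulr_lge0 ?invr_gt0// subr_ge0.
Qed.

Section pair.
Variables (X Y : T -> R) (a b c : 'I_K -> R).
Hypotheses (mX : measurable_fun setT X) (mY : measurable_fun setT Y).
Hypotheses (cf : mixture_cf X Y a b c) (q : forall k, psd_form (a k) (b k) (c k)).

Lemma mixture_moment_sqrl : Rintegrable P (fun w => X w ^+ 2) /\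
  \int[P]_w (X w ^+ 2) = \sum_k p k * a k.
Proof.
apply: mixture_second_moment => // [k|s]; first by have [] := psd_form_ge0 (q k).
have := cf s 0; under eq_Rintegral do rewrite mul0r addr0.
by move=> ->; apply: eq_bigr => k _; rewrite expr0n/= !mulr0 !addr0.
Qed.

Lemma mixture_moment_sqrr : Rintegrable P (fun w => Y w ^+ 2) /\
  \int[P]_w (Y w ^+ 2) = \sum_k p k * b k.
Proof.
apply: mixture_second_moment => // [k|t]; first by have [] := psd_form_ge0 (q k).
have := cf 0 t; under eq_Rintegral do rewrite mul0r add0r.
by move=> ->; apply: eq_bigr => k _; rewrite expr0n/= !mulr0 mul0r !add0r.
Qed.

Lemma mixture_moment_sqrD : Rintegrable P (fun w => (X w + Y w) ^+ 2) /\
  \int[P]_w ((X w + Y w) ^+ 2) = \sum_k p k * (a k + 2 * c k + b k).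
Proof.
apply: mixture_second_moment => // [|k|s]; first by mfun.
  by have := q k 1 1; rewrite expr1n !mulr1.
have := cf s s; under eq_Rintegral do rewrite -mulrDr.
by move=> ->; apply: eq_bigr => k _; congr (_ * expR _); ring.
Qed.

Lemma Rintegrable_mixtureM : Rintegrable P (fun w => X w * Y w).
Proof.
have [iX _] := mixture_moment_sqrl; have [iY _] := mixture_moment_sqrr.
apply: (Rintegrable_le _ _ (RintegrableD iX iY)); first by mfun.
move=> w; rewrite ler_norml.
have H1 : 0 <= X w ^+ 2 + Y w ^+ 2 + 2 * (X w * Y w).
  by rewrite (_ : _ + _ = (X w + Y w) ^+ 2) ?sqr_ge0//; ring.
have H2 : 0 <= X w ^+ 2 + Y w ^+ 2 - 2 * (X w * Y w).
  by rewrite (_ : _ - _ = (X w - Y w) ^+ 2) ?sqr_ge0//; ring.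
have H3 := sqr_ge0 (X w); have H4 := sqr_ge0 (Y w).
by apply/andP; split; lra.
Qed.

(** Polarization: the second moments of X, Y and X + Y come from the joint characteristic function
    on the two axes and the diagonal. *)
Lemma mixture_moment : \int[P]_w (X w * Y w) = \sum_k p k * c k.
Proof.
have [iX EX] := mixture_moment_sqrl; have [iY EY] := mixture_moment_sqrr.
have [iD ED] := mixture_moment_sqrD; have iM := Rintegrable_mixtureM.
have : \int[P]_w ((X w + Y w) ^+ 2) =
    \int[P]_w (X w ^+ 2) + 2 * \int[P]_w (X w * Y w) + \int[P]_w (Y w ^+ 2).
  rewrite -RintegralZl// -RintegralD//; last exact: RintegrableZl.
  rewrite -RintegralD//; last by apply: RintegrableD => //; exact: RintegrableZl.
  by apply: eq_Rintegral => w _; ring.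
rewrite ED EX EY => H.
have : \sum_k p k * (a k + 2 * c k + b k) =
    \sum_k p k * a k + 2 * (\sum_k p k * c k) + \sum_k p k * b k.
  by rewrite mulr_sumr -!big_split/=; apply: eq_bigr => k _; ring.
by rewrite H => {}H; lra.
Qed.

Lemma Rintegrable_mixturer : Rintegrable P Y.
Proof.
have [iY _] := mixture_moment_sqrr.
have i1 : Rintegrable P (cst 1).
  by apply: (Rintegrable_bounded P (M := 1)) => // t; rewrite normr1.
apply: (Rintegrable_le mY _ (RintegrableD i1 iY)) => w /=.
have H1 : 0 <= Y w ^+ 2 + 1 + 2 * Y w.
  by rewrite (_ : _ + _ = (Y w + 1) ^+ 2) ?sqr_ge0//; ring.
have H2 : 0 <= Y w ^+ 2 + 1 - 2 * Y w.
  by rewrite (_ : _ - _ = (Y w - 1) ^+ 2) ?sqr_ge0//; ring.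
have H3 := sqr_ge0 (Y w); rewrite ler_norml.
by apply/andP; split; lra.
Qed.

(** The product of sines is half a difference of cosines whose exponents differ only in the sign of
    the cross term, hence the [sinh]. *)
Lemma mixture_sin_sin s t : \int[P]_w (sin (s * X w) * sin (t * Y w)) =
  \sum_k p k * (expR (- ((a k * s ^+ 2 + b k * t ^+ 2) / 2)) * sinh (c k * s * t)).
Proof.
have ic u v : Rintegrable P (fun w => cos (u * X w + v * Y w)).
  by apply: (Rintegrable_bounded P (M := 1)) => [|w]; [mfun|exact: cos_max].
transitivity (2^-1 * (\int[P]_w cos (s * X w + (- t) * Y w) - \int[P]_w cos (s * X w + t * Y w))).
  rewrite -(RintegralB measurableT (ic _ _) (ic _ _)).
  rewrite -RintegralZl//; last by apply: RintegrableB; exact: ic.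
  by apply: eq_Rintegral => w _; rewrite mulNr cosB cosD; field.
rewrite !cf -sumrB mulr_sumr; apply: eq_bigr => k _.
rewrite (_ : - ((a k * s ^+ 2 + 2 * c k * s * - t + b k * (- t) ^+ 2) / 2) =
  - ((a k * s ^+ 2 + b k * t ^+ 2) / 2) + c k * s * t); last by field.
rewrite (_ : - ((a k * s ^+ 2 + 2 * c k * s * t + b k * t ^+ 2) / 2) =
  - ((a k * s ^+ 2 + b k * t ^+ 2) / 2) - c k * s * t); last by field.
by rewrite !expRD /sinh; ring.
Qed.

(** The derivative of [mixture_sin_sin] in [t] at 0; the difference quotients of sin(t Y) are
    dominated by |Y|. *)
Lemma mixture_sin_mul s : \int[P]_w (sin (s * X w) * Y w) =
  \sum_k p k * (expR (- (a k * s ^+ 2 / 2)) * (c k * s)).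
Proof.
pose h n : R := n.+1%:R^-1.
have h0 n : 0 < h n by rewrite invr_gt0.
have hl : h n @[n --> \oo] --> 0 := @cvg_harmonic0 R.
have iY := Rintegrable_mixturer.
have L : \int[P]_w (sin (s * X w) * ((h n)^-1 * sin (h n * Y w))) @[n --> \oo] -->
    \int[P]_w (sin (s * X w) * Y w).
  apply: (proj2 (Rintegral_dominated (g := fun w => `|Y w|) _ _ _ _)).
  - by move=> n; mfun.
  - move=> w; apply: cvgM; first exact: cvg_cst.
    have dF : is_derive (0 : R) 1 (fun u => sin (u * Y w)) (Y w).
      by apply: is_derive_eq; rewrite mul0r cos0 /GRing.scale/=; ring.
    have := cvg_difference_quotient dF hl (fun n => lt0r_neq0 (h0 n)).
    by under eq_fun do rewrite mul0r sin0 subr0.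
  - exact: Rintegrable_norm.
  - move=> n w; rewrite normrM -[leRHS]mul1r ler_pM// ?sin_max//.
    rewrite normrM normfV (gtr0_norm (h0 n)) ler_pdivrMl//.
    by rewrite (le_trans (norm_sin_le _))// normrM (gtr0_norm (h0 n)).
have L' : \int[P]_w (sin (s * X w) * ((h n)^-1 * sin (h n * Y w))) @[n --> \oo] -->
    \sum_k p k * (expR (- (a k * s ^+ 2 / 2)) * (c k * s)).
  rewrite (_ : (fun n => _) = (fun n => \sum_k p k *
      ((h n)^-1 * (expR (- ((a k * s ^+ 2 + b k * (h n) ^+ 2) / 2)) * sinh (c k * s * h n))))).
    apply: cvg_finsum => k; apply: cvgM; first exact: cvg_cst.
    have dF : is_derive (0 : R) 1
        (fun u => expR (- ((a k * s ^+ 2 + b k * u ^+ 2) / 2)) * sinh (c k * s * u))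
        (expR (- (a k * s ^+ 2 / 2)) * (c k * s)).
      rewrite /sinh; apply: is_derive_eq.
      rewrite /GRing.scale/= !mulr0 !expr0n/= !mulr0 oppr0 expR0 !addr0; by field.
    have := cvg_difference_quotient dF hl (fun n => lt0r_neq0 (h0 n)).
    by under eq_fun do rewrite [c k * s * 0]mulr0 sinh0 mulr0 subr0.
  apply/funext => n.
  transitivity ((h n)^-1 * \int[P]_w (sin (s * X w) * sin (h n * Y w))).
    rewrite -RintegralZl//; last first.
      apply: (Rintegrable_bounded P (M := 1)) => [|w]; first by mfun.
      by rewrite normrM mulr_ile1// sin_max.
    by apply: eq_Rintegral => w _; ring.
  by rewrite mixture_sin_sin mulr_sumr; apply: eq_bigr => k _; ring.
by rewrite -(cvg_lim (@Rhausdorff R) L) (cvg_lim (@Rhausdorff R) L').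
Qed.

Lemma gauss_sqrtE (x s : R) : 0 <= x -> expR (- (x * s ^+ 2 / 2)) = gauss (Num.sqrt x) s.
Proof. by move=> x0; rewrite /gauss exprMn sqr_sqrtr. Qed.

(* Price-type formula: a Gaussian signal is correlated with the sign of another one. *)
Lemma mixture_sgr_mul : (forall k, 0 < a k) ->
  \int[P]_w (Num.sg (X w) * Y w) = Num.sqrt (2 / pi) * \sum_k p k * (c k / Num.sqrt (a k)).
Proof.
move=> a0; have sa0 k : 0 < Num.sqrt (a k) by rewrite sqrtr_gt0.
(* The factor [s] of [mixture_sin_mul] cancels the division by [s] and leaves integrable
   Gaussians. *)
have E s : s != 0 -> \sum_k p k * c k * gauss (Num.sqrt (a k)) s =
   (\int[P]_w (sin (s * X w) * Y w)) / s.
  move=> s0; rewrite mixture_sin_mul mulr_suml; apply: eq_bigr => k _.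
  by rewrite gauss_sqrtE ?ltW//; field.
have ig k : Rintegrable mu (fun s => p k * c k * gauss (Num.sqrt (a k)) s).
  by apply: RintegrableZl; have [] := gauss_integral (sa0 k).
have ig' := Rintegrable_sum ig.
have Eall (s : R) : (\int[P]_w (sin (s * X w) * Y w)) / s =
    (\sum_k p k * c k * gauss (Num.sqrt (a k)) s) * (s * s^-1).
  have [->|s0] := eqVneq s 0; first by rewrite invr0 !mulr0.
  by rewrite -E// divff// mulr1.
have mo : measurable_fun setT (fun s : R => (\int[P]_w (sin (s * X w) * Y w)) / s).
  by rewrite (funext Eall); apply: measurable_funM; [exact: (Rintegrable_measurable ig')|mfun].
rewrite Rintegral_sgr_inversion//.
- rewrite -(Rintegral_punctured (Rintegrable_measurable ig') mo E) Rintegral_sum//.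
  rewrite !mulr_sumr; apply: eq_bigr => k _.
  have [i Eg] := gauss_integral (sa0 k); rewrite RintegralZl// Eg.
  have -> : Num.sqrt (2 / pi) = pi^-1 * Num.sqrt (2 * pi) :> R.
    rewrite (_ : 2 / pi = (pi^-1) ^+ 2 * (2 * pi)); last first.
      by have := lt0r_neq0 (pi_gt0 R); move: (pi : R) => x x0; field.
    by rewrite sqrtrM ?sqr_ge0// sqrtr_sqr ger0_norm// invr_ge0 pi_ge0.
  by ring.
- exact: Rintegrable_mixturer.
- exact: Rintegrable_mixtureM.
- apply: (Rintegrable_le (mu := mu) mo _ (Rintegrable_norm ig')) => s.
  rewrite Eall normrM ler_piMr//.
  by have [->|s0] := eqVneq s 0; [rewrite mul0r normr0|rewrite divff// normr1].
Qed.

End pair.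
End mixture.

(** * The arcsine law for a pair of signs *)

Section arcsine.
Context (R : realType) d (T : measurableType d) (P : probability T R).
Notation mu := (@lebesgue_measure R).
Variables (K : nat) (p : 'I_K -> R).
Hypothesis p1 : \sum_k p k = 1.
Variables (X Y : T -> R) (a b c : 'I_K -> R).
Hypotheses (mX : measurable_fun setT X) (mY : measurable_fun setT Y).
Hypotheses (cf : mixture_cf P p X Y a b c) (q : forall k, psd_form (a k) (b k) (c k)).

Lemma Rintegrable_mixturel : Rintegrable P X.
Proof.
apply: (@Rintegrable_mixturer _ _ _ P K p p1 Y X b a c) => //.
  move=> s t; rewrite -[RHS](_ : \int[P]_w cos (t * X w + s * Y w) = _).
    by apply: eq_Rintegral => w _; rewrite addrC.
  by rewrite cf; apply: eq_bigr => k _; congr (_ * expR _); ring.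
by move=> k s t; have := q k t s; congr (0 <= _); ring.
Qed.

(** Inverting both signs turns the expectation of [mixture_sin_sin] into the integral of
    [orthant_kernel]; the factors 1/pi, 1/pi and 2 pi combine to 2/pi. *)
Theorem mixture_sgr_sgr : (forall k, 0 < a k) -> (forall k, 0 < b k) ->
  \int[P]_w (Num.sg (X w) * Num.sg (Y w)) =
  2 / pi * \sum_k p k * asin (c k / (Num.sqrt (a k) * Num.sqrt (b k))).
Proof.
move=> a0 b0; have sa0 k : 0 < Num.sqrt (a k) by rewrite sqrtr_gt0.
have sb0 k : 0 < Num.sqrt (b k) by rewrite sqrtr_gt0.
have pi0 : pi != 0 :> R := lt0r_neq0 (pi_gt0 R).
have iX := Rintegrable_mixturel; have iY := Rintegrable_mixturer p1 mY cf q.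
have ib (f : T -> R) : measurable_fun setT f -> (forall w, `|f w| <= 1) -> Rintegrable P f.
  exact: Rintegrable_bounded.
have sg1 (x : R) : `|Num.sg x| <= 1 by rewrite normr_sg lern1 leq_b1.
have ibM (f g : T -> R) : Rintegrable P f -> measurable_fun setT g ->
    (forall w, `|g w| <= 1) -> Rintegrable P (fun w => f w * g w).
  move=> fi mg g1; apply: (Rintegrable_le _ _ (Rintegrable_norm fi)).
    by apply: measurable_funM => //; exact: Rintegrable_measurable fi.
  by move=> w; rewrite normrM ler_piMr.
(* First inversion: the sign of [Y], with the bounded weight sin(s X). *)
have step1 s : (\int[P]_w (sin (s * X w) * Num.sg (Y w))) / s =
    \sum_k pi^-1 * p k * orthant_kernel (Num.sqrt (a k)) (Num.sqrt (b k)) (c k) s.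
  have F t : (\int[P]_w (sin (t * Y w) * sin (s * X w))) / t =
      \sum_k p k * gauss (Num.sqrt (a k)) s * (gauss (Num.sqrt (b k)) t * (sinh (c k * s * t) / t)).
    under eq_Rintegral do rewrite mulrC.
    rewrite (mixture_sin_sin mX mY cf) mulr_suml; apply: eq_bigr => k _.
    rewrite -!gauss_sqrtE ?ltW//.
    rewrite (_ : - ((a k * s ^+ 2 + b k * t ^+ 2) / 2) =
      - (a k * s ^+ 2 / 2) + - (b k * t ^+ 2 / 2)); last by field.
    by rewrite expRD; ring.
  have ik k : Rintegrable mu (fun t => p k * gauss (Num.sqrt (a k)) s *
      (gauss (Num.sqrt (b k)) t * (sinh (c k * s * t) / t))).
    by apply: RintegrableZl; exact: Rintegrable_gauss_sinh.
  under eq_Rintegral do rewrite mulrC.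
  rewrite (Rintegral_sgr_inversion mY (W := fun w => sin (s * X w))).
  - under eq_Rintegral do rewrite F.
    rewrite Rintegral_sum// mulr_sumr mulr_suml; apply: eq_bigr => k _.
    by rewrite RintegralZl ?/orthant_kernel//; [ring|exact: Rintegrable_gauss_sinh].
  - by apply: ib => [|w]; [mfun|exact: sin_max].
  - by apply: ibM => // [|w]; [mfun|exact: sin_max].
  - by under eq_fun do rewrite F; exact: Rintegrable_sum.
have c_le k : `|c k| <= Num.sqrt (a k) * Num.sqrt (b k) by have [] := psd_form_ge0 (q k).
have ok k := integral_orthant_kernel (sa0 k) (sb0 k) (c_le k).
have iok k : Rintegrable mu (fun s => pi^-1 * p k *
    orthant_kernel (Num.sqrt (a k)) (Num.sqrt (b k)) (c k) s).
  by apply: RintegrableZl; exact: (ok k).1.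
(* Second inversion: the sign of [X], with the sign of [Y] as weight. *)
rewrite (Rintegral_sgr_inversion mX (W := fun w => Num.sg (Y w))).
- under eq_Rintegral do rewrite step1.
  rewrite Rintegral_sum// !mulr_sumr; apply: eq_bigr => k _.
  rewrite RintegralZl//; last exact: (ok k).1.
  by rewrite (ok k).2; move: pi0; move: (pi : R) => x x0; field.
- by apply: ib => //; mfun.
- by apply: ibM => //; mfun.
- by under eq_fun do rewrite step1; exact: Rintegrable_sum.
Qed.

End arcsine.

(** * Factorization of expectations under independence *)

Section independence.
Context (R : realType) d (T : measurableType d) (P : probability T R).

(** The product rule on preimages identifies the joint law with the product of the marginal laws, by
    uniqueness of the product measure; Fubini then factors the integral. *)
Lemma Rintegral_indep (U V : T -> R) (f g : R -> R) :
  measurable_fun setT U -> measurable_fun setT V ->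
  (forall A B : set R, measurable A -> measurable B ->
    P (U @^-1` A `&` V @^-1` B) = (P (U @^-1` A) * P (V @^-1` B))%E) ->
  measurable_fun setT f -> measurable_fun setT g ->
  (forall x, `|f x| <= 1) -> (forall x, `|g x| <= 1) ->
  \int[P]_t (f (U t) * g (V t)) = (\int[P]_t f (U t)) * (\int[P]_t g (V t)).
Proof.
move=> mU mV UV mf mg f1 g1.
have mW : measurable_fun setT (fun t => (U t, V t)) by exact: measurable_fun_pair.
pose U' : {mfun T >-> R} := HB.pack U (isMeasurableFun.Build _ _ _ _ U mU).
pose V' : {mfun T >-> R} := HB.pack V (isMeasurableFun.Build _ _ _ _ V mV).
pose W' : {mfun T >-> (R * R)%type} := HB.pack (fun t => (U t, V t)) (isMeasurableFun.Build _ _ _ _ (fun t => (U t, V t)) mW).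
pose F (z : R * R) := f z.1 * g z.2.
have mF : measurable_fun setT F.
  by rewrite /F; apply: measurable_funM; [apply: (measurableT_comp mf)|apply: (measurableT_comp mg)].
have i1 (Q : probability R R) : Rintegrable Q (cst 1).
  by apply: (Rintegrable_bounded Q (M := 1)) => // t; rewrite normr1.
have Fb x y : `|F (x, y)| <= cst 1 x * cst 1 y by rewrite /F/= mul1r normrM mulr_ile1.
have iF := Rintegrable_prod mF (i1 (distribution P U')) (i1 (distribution P V')) Fb.
have EF := Rintegral_prod mF (i1 (distribution P U')) (i1 (distribution P V')) Fb.
have PW : (\int[distribution P W']_z (F z)%:E =
    \int[(distribution P U') \x (distribution P V')]_z (F z)%:E)%E.
  apply: eq_measure_integral => A mA _; apply/esym.
  apply: product_measure_unique => // B C mB mC; exact: UV.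
have iW : P.-integrable setT ((EFin \o F) \o W').
  apply: (Rintegrable_bounded P (M := 1) (f := F \o W')) => [|z].
    exact: (measurableT_comp mF mW).
  by rewrite /F/= normrM mulr_ile1.
have -> : \int[P]_t (f (U t) * g (V t)) = fine (\int[distribution P W']_z (F z)%:E)%E.
  rewrite /Rintegral; congr fine; rewrite integral_distribution//.
  exact/measurable_EFinP.
rewrite PW -EF.
have if' : Rintegrable (distribution P U') f by apply: Rintegrable_bounded mf f1.
have ig' : Rintegrable (distribution P V') g by apply: Rintegrable_bounded mg g1.
transitivity (\int[distribution P U']_x (f x * \int[distribution P V']_y g y)).
  by apply: eq_Rintegral => x _; rewrite -RintegralZl.
rewrite RintegralZr//; congr (_ * _).
  rewrite /Rintegral integral_distribution//; first exact/measurable_EFinP.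
  apply: (Rintegrable_bounded P (M := 1) (f := f \o U)) => [|z]; last exact: f1.
  exact: (measurableT_comp mf mU).
rewrite /Rintegral integral_distribution//; first exact/measurable_EFinP.
apply: (Rintegrable_bounded P (M := 1) (f := g \o V)) => [|z]; last exact: g1.
exact: (measurableT_comp mg mV).
Qed.

End independence.

(** * Real forms attached to complex matrices *)

Section hermitian_forms.
Variable R : realType.
Local Notation C := R[i].
Local Open Scope complex_scope.

Lemma hermtE m n (X : 'M[C]_(m, n)) : hermt X = (map_mx conjc X)^T.
Proof. by apply/matrixP => i j; rewrite !mxE; case: (X j i). Qed.

Lemma hermtM m n q (X : 'M[C]_(m, n)) (Y : 'M[C]_(n, q)) :
  hermt (X *m Y) = hermt Y *m hermt X.
Proof. by rewrite !hermtE map_mxM trmx_mul. Qed.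

Lemma hermtD m n (X Y : 'M[C]_(m, n)) : hermt (X + Y) = hermt X + hermt Y.
Proof. by rewrite !hermtE map_mxD linearD. Qed.

Lemma hermtZ m n (z : C) (X : 'M[C]_(m, n)) : hermt (z *: X) = conjc z *: hermt X.
Proof. by rewrite !hermtE map_mxZ linearZ. Qed.

Lemma hermtK m n (X : 'M[C]_(m, n)) : hermt (hermt X) = X.
Proof. by rewrite !hermtE; apply/matrixP => i j; rewrite !mxE conjcK. Qed.

Lemma hermt0 m n : hermt (0 : 'M[C]_(m, n)) = 0.
Proof. by rewrite hermtE map_mx0 trmx0. Qed.

Lemma ReM (x y : C) : complex.Re (x * y) = complex.Re x * complex.Re y - complex.Im x * complex.Im y.
Proof. by case: x => a b; case: y. Qed.

Lemma ImM (x y : C) : complex.Im (x * y) = complex.Re x * complex.Im y + complex.Im x * complex.Re y.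
Proof. by case: x => a b; case: y. Qed.

Lemma ReD (x y : C) : complex.Re (x + y) = complex.Re x + complex.Re y.
Proof. by case: x => a b; case: y. Qed.

Lemma ImD (x y : C) : complex.Im (x + y) = complex.Im x + complex.Im y.
Proof. by case: x => a b; case: y. Qed.

Lemma Re_sum (I : Type) (r : seq I) (F : I -> C) :
  complex.Re (\sum_(i <- r) F i) = \sum_(i <- r) complex.Re (F i).
Proof. by elim/big_ind2 : _ => // x1 x2 y1 y2 <- <-; rewrite ReD. Qed.

Lemma Im_sum (I : Type) (r : seq I) (F : I -> C) :
  complex.Im (\sum_(i <- r) F i) = \sum_(i <- r) complex.Im (F i).
Proof. by elim/big_ind2 : _ => // x1 x2 y1 y2 <- <-; rewrite ImD. Qed.

Lemma ReZ (s : R) (x : C) : complex.Re (s%:C * x) = s * complex.Re x.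
Proof. by rewrite ReM /= mul0r subr0. Qed.

Lemma ImZ (s : R) (x : C) : complex.Im (s%:C * x) = s * complex.Im x.
Proof. by rewrite ImM /= mul0r addr0. Qed.

(** The real part makes the sesquilinear form real bilinear, the shape taken by covariances of real
    functionals. *)
Definition bform m n (X : 'M[C]_(m, n)) (u : 'cV[C]_m) (v : 'cV[C]_n) : R :=
  complex.Re ((hermt u *m X *m v) 0 0).

(** The general real linear functional of [v]; a unit vector times 1 or ['i] as [u] picks the real
    or the imaginary part of a coordinate. *)
Definition rdot n (u v : 'cV[C]_n) : R := complex.Re ((hermt u *m v) 0 0).

Section bform.
Variables (m n : nat) (X : 'M[C]_(m, n)).

Lemma bformDl u u' v : bform X (u + u') v = bform X u v + bform X u' v.
Proof. by rewrite /bform hermtD !mulmxDl mxE ReD. Qed.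

Lemma bformDr u v v' : bform X u (v + v') = bform X u v + bform X u v'.
Proof. by rewrite /bform mulmxDr mxE ReD. Qed.

Lemma bformZl s u v : bform X (s%:C *: u) v = s * bform X u v.
Proof. by rewrite /bform hermtZ -!scalemxAl mxE conjc_real ReZ. Qed.

Lemma bformZr s u v : bform X u (s%:C *: v) = s * bform X u v.
Proof. by rewrite /bform -scalemxAr mxE ReZ. Qed.

Lemma bform0r u : bform X u 0 = 0.
Proof. by rewrite /bform mulmx0 mxE. Qed.

Lemma bform0l v : bform X 0 v = 0.
Proof. by rewrite /bform hermt0 !mul0mx mxE. Qed.

Lemma bform_mulmx m' n' (A : 'M[C]_(m', m)) (B : 'M[C]_(n', n)) u v :
  bform (A *m X *m hermt B) u v = bform X (hermt A *m u) (hermt B *m v).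
Proof. by rewrite /bform hermtM hermtK !mulmxA. Qed.

Lemma bform_mulmxr n' (B : 'M[C]_(n', n)) u v :
  bform (X *m hermt B) u v = bform X u (hermt B *m v).
Proof. by rewrite /bform !mulmxA. Qed.

Lemma bform_unit i j (z z' : C) :
  bform X (z *: delta_mx i 0) (z' *: delta_mx j 0) = complex.Re (conjc z * X i j * z').
Proof.
rewrite /bform hermtZ -!scalemxAl -scalemxAr mxE mxE.
rewrite (_ : hermt (delta_mx i 0) = delta_mx 0 i); last first.
  by rewrite hermtE map_delta_mx trmx_delta.
by rewrite -rowE -colE !mxE mulrA mulrAC.
Qed.

End bform.

Lemma bform_add m n (X Y : 'M[C]_(m, n)) u v : bform (X + Y) u v = bform X u v + bform Y u v.
Proof. by rewrite /bform mulmxDr mulmxDl mxE ReD. Qed.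

Lemma bform_sym n (X : 'M[C]_n) u v : hermt X = X -> bform X u v = bform X v u.
Proof.
move=> HX; rewrite /bform.
have -> : hermt u *m X *m v = hermt (hermt v *m X *m u) by rewrite !hermtM hermtK HX mulmxA.
by rewrite /hermt !mxE.
Qed.

Lemma bform_ge0 n (X : 'M[C]_n) u : herm_psd X -> 0 <= bform X u u.
Proof. by move=> [_ /(_ u)]; rewrite lecE => /andP[]. Qed.

Lemma rdotDl n (u u' v : 'cV[C]_n) : rdot (u + u') v = rdot u v + rdot u' v.
Proof. by rewrite /rdot hermtD mulmxDl mxE ReD. Qed.

Lemma rdotDr n (u v v' : 'cV[C]_n) : rdot u (v + v') = rdot u v + rdot u v'.
Proof. by rewrite /rdot mulmxDr mxE ReD. Qed.

Lemma rdotZl n s (u v : 'cV[C]_n) : rdot (s%:C *: u) v = s * rdot u v.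
Proof. by rewrite /rdot hermtZ -scalemxAl mxE conjc_real ReZ. Qed.

Lemma rdot0l n (v : 'cV[C]_n) : rdot 0 v = 0.
Proof. by rewrite /rdot hermt0 mul0mx mxE. Qed.

Lemma rdot_mulmx m n (A : 'M[C]_(m, n)) u v : rdot u (A *m v) = rdot (hermt A *m u) v.
Proof. by rewrite /rdot hermtM hermtK mulmxA. Qed.

Lemma rdotE n (u v : 'cV[C]_n) :
  rdot u v = \sum_j (complex.Re (u j 0) * complex.Re (v j 0) +
                     complex.Im (u j 0) * complex.Im (v j 0)).
Proof.
rewrite /rdot mxE Re_sum; apply: eq_bigr => j _.
by rewrite /hermt !mxE ReM /cconj/= mulNr opprK.
Qed.

Lemma rdot_unit n i (z : C) (v : 'cV[C]_n) :
  rdot (z *: delta_mx i 0) v = complex.Re (conjc z * v i 0).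
Proof.
rewrite /rdot hermtZ -scalemxAl mxE (_ : hermt (delta_mx i 0) = delta_mx 0 i).
  by rewrite -rowE mxE.
by rewrite hermtE map_delta_mx trmx_delta.
Qed.

Lemma rdot_Re n i (v : 'cV[C]_n) : rdot (1 *: delta_mx i 0) v = complex.Re (v i 0).
Proof. by rewrite rdot_unit conjc1 mul1r. Qed.

Lemma rdot_Im n i (v : 'cV[C]_n) : rdot ('i *: delta_mx i 0) v = complex.Im (v i 0).
Proof. by rewrite rdot_unit ReM/= mul0r sub0r mulN1r opprK. Qed.

Lemma herm_psd_scalar n (e : R) : 0 <= e -> herm_psd (e%:C *: 1%:M : 'M[C]_n).
Proof.
move=> e0; split.
  by rewrite hermtZ conjc_real hermtE map_mx1 trmx1.
move=> v; rewrite -scalemxAr -scalemxAl mulmx1 mxE mulr_ge0 ?ler0c// mxE sumr_ge0// => i _.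
by rewrite hermtE !mxE mulrC mulcJ_ge0.
Qed.

Context d (T : measurableType d).

Lemma measurable_fun_rdot n (u : 'cV[C]_n) (h : T -> 'cV[C]_n) :
  cmx_measurable h -> measurable_fun setT (fun t => rdot u (h t)).
Proof.
move=> mh; under eq_fun do rewrite rdotE.
apply: measurable_sum => j; have [m1 m2] := mh j 0.
by apply: measurable_funD; apply: measurable_funM.
Qed.

End hermitian_forms.

(** * Joint law of real linear functionals of signal and noise *)

Section linear_functionals.
Local Open Scope complex_scope.
Context (R : realType) d (T : measurableType d) (P : probability T R).
Local Notation C := R[i].

(** When the domain carries the sigma-algebra generated by the entries of [h], the vector [h] is
    measurable, and so is every [rdot u]. Independence thus passes from vectors to functionals. *)
Lemma cmx_sigma_rdot n (u : 'cV[C]_n) (h : T -> 'cV[C]_n) (B : set R) :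
  measurable B -> cmx_sigma h ((fun t => rdot u (h t)) @^-1` B).
Proof.
move=> mB.
pose G := [set A | exists i j, exists2 B : set R, measurable B &
   (A = (fun t => complex.Re (h t i j)) @^-1` B \/ A = (fun t => complex.Im (h t i j)) @^-1` B)].
have mh : cmx_measurable (h : g_sigma_algebraType G -> 'cV[C]_n).
  move=> i j; split=> _ D mD; rewrite setTI; apply: sub_sigma_algebra;
    exists i, j, D => //; first [by left|by right].
have := measurable_fun_rdot u mh measurableT mB.
by rewrite setTI.
Qed.

Variables (K N L : nat) (p : 'I_K -> R) (Cs : 'I_K -> 'M[C]_N) (E : 'M[C]_L).
Variables (h : T -> 'cV[C]_N) (n : T -> 'cV[C]_L).
Hypotheses (psdC : forall k, herm_psd (Cs k)) (psdE : herm_psd E).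
Hypotheses (mh : cmx_measurable h) (mn : cmx_measurable n).
Hypotheses (hcf : has_cf P h (gmix_cf p Cs)) (ncf : has_cf P n (cgauss_cf E)).
Hypothesis hn : cindep P h n.

Definition lin (W : 'cV[C]_N * 'cV[C]_L) (t : T) : R := rdot W.1 (h t) + rdot W.2 (n t).

(** The half is the circular convention: the characteristic function exp(-w^H C w / 4) gives the
    functional [rdot w] the variance w^H C w / 2. *)
Definition lin_cov (k : 'I_K) (W W' : 'cV[C]_N * 'cV[C]_L) : R :=
  (bform (Cs k) W.1 W'.1 + bform E W.2 W'.2) / 2.

Lemma measurable_lin W : measurable_fun setT (lin W).
Proof. by apply: measurable_funD; exact: measurable_fun_rdot. Qed.

Lemma cf_cos_h u : \int[P]_t cos (rdot u (h t)) = \sum_k p k * expR (- bform (Cs k) u u / 4).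
Proof.
have /(congr1 (@complex.Re R)) /= -> := hcf u.
by rewrite /gmix_cf Re_sum; apply: eq_bigr => k _; rewrite ReZ.
Qed.

Lemma cf_sin_h u : \int[P]_t sin (rdot u (h t)) = 0.
Proof.
have /(congr1 (@complex.Im R)) /= -> := hcf u.
by rewrite /gmix_cf Im_sum big1// => k _; rewrite ImZ mulr0.
Qed.

Lemma cf_cos_n v : \int[P]_t cos (rdot v (n t)) = expR (- bform E v v / 4).
Proof. by have /(congr1 (@complex.Re R)) /= -> := ncf v. Qed.

(** Expand the cosine of the sum and factor by independence; the sine term vanishes because the
    characteristic function of [h] is real. *)
Lemma cf_lin W : \int[P]_t cos (lin W t) = \sum_k p k * expR (- (lin_cov k W W / 2)).
Proof.
have mU := measurable_fun_rdot W.1 mh; have mV := measurable_fun_rdot W.2 mn.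
have ind (A B : set R) (mA : measurable A) (mB : measurable B) :
  P ((fun t => rdot W.1 (h t)) @^-1` A `&` (fun t => rdot W.2 (n t)) @^-1` B) =
  (P ((fun t => rdot W.1 (h t)) @^-1` A) * P ((fun t => rdot W.2 (n t)) @^-1` B))%E.
  by apply: hn; exact: cmx_sigma_rdot.
have mc : measurable_fun [set: R] (@cos R) by mfun.
have ms : measurable_fun [set: R] (@sin R) by mfun.
have Ec := Rintegral_indep mU mV ind mc mc (@cos_max R) (@cos_max R).
have Es := Rintegral_indep mU mV ind ms ms (@sin_max R) (@sin_max R).
transitivity (\int[P]_t (cos (rdot W.1 (h t)) * cos (rdot W.2 (n t))) -
              \int[P]_t (sin (rdot W.1 (h t)) * sin (rdot W.2 (n t)))).
  rewrite -RintegralB//.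
  - by apply: eq_Rintegral => t _; rewrite cosD.
  - by apply: (Rintegrable_bounded P (M := 1)) => [|t]; [mfun|rewrite normrM mulr_ile1// cos_max].
  - by apply: (Rintegrable_bounded P (M := 1)) => [|t]; [mfun|rewrite normrM mulr_ile1// sin_max].
rewrite Ec Es cf_sin_h mul0r subr0 cf_cos_h cf_cos_n mulr_suml; apply: eq_bigr => k _.
by rewrite -mulrA -expRD /lin_cov; congr (_ * expR _); field.
Qed.

Definition lin_comb (s t : R) (W W' : 'cV[C]_N * 'cV[C]_L) : 'cV[C]_N * 'cV[C]_L :=
  (s%:C *: W.1 + t%:C *: W'.1, s%:C *: W.2 + t%:C *: W'.2).

Lemma lin_cov_comb k s t W W' : lin_cov k (lin_comb s t W W') (lin_comb s t W W') =
  lin_cov k W W * s ^+ 2 + 2 * lin_cov k W W' * s * t + lin_cov k W' W' * t ^+ 2.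
Proof.
rewrite /lin_cov /lin_comb/= !bformDl !bformDr !bformZl !bformZr.
rewrite (bform_sym W'.1 W.1 (psdC k).1) (bform_sym W'.2 W.2 psdE.1).
by field.
Qed.

(** A combination of two functionals is again a functional, so [cf_lin] along all combinations is
    the joint characteristic function. *)
Lemma lin_mixture W W' : mixture_cf P p (lin W) (lin W')
  (fun k => lin_cov k W W) (fun k => lin_cov k W' W') (fun k => lin_cov k W W').
Proof.
move=> s t; transitivity (\int[P]_w cos (lin (lin_comb s t W W') w)).
  apply: eq_Rintegral => w _; congr cos; rewrite /lin/= !rdotDl !rdotZl; ring.
by rewrite cf_lin; apply: eq_bigr => k _; rewrite lin_cov_comb.
Qed.

Lemma lin_cov_ge0 k W : 0 <= lin_cov k W W.
Proof. by rewrite divr_ge0// addr_ge0// bform_ge0. Qed.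

Lemma lin_psd k W W' : psd_form (lin_cov k W W) (lin_cov k W' W') (lin_cov k W W').
Proof. by move=> s t; rewrite -lin_cov_comb lin_cov_ge0. Qed.

End linear_functionals.

(** * Moments of the observation and of its one-bit quantization *)

Section bussgang.
Local Open Scope complex_scope.
Context (R : realType) d (T : measurableType d) (P : probability T R).
Local Notation C := R[i].
Variables (K N L : nat) (p : 'I_K -> R) (Cs : 'I_K -> 'M[C]_N) (A : 'M[C]_(L, N)) (eta2 : R).
Variables (h : T -> 'cV[C]_N) (n : T -> 'cV[C]_L).
Local Notation noise := (eta2%:C *: (1%:M : 'M[C]_L)).
Hypotheses (p1 : \sum_k p k = 1) (psdC : forall k, herm_psd (Cs k)) (eta0 : 0 < eta2).
Hypotheses (mh : cmx_measurable h) (mn : cmx_measurable n).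
Hypotheses (hcf : has_cf P h (gmix_cf p Cs)) (ncf : has_cf P n (cgauss_cf noise)).
Hypothesis hn : cindep P h n.

Let y t := A *m h t + n t.
Let r t := Qvec (y t).
Let Cy k := A *m Cs k *m hermt A + noise.
Let S k j := Num.sqrt (complex.Re (Cy k j j)).
(** Represents Re(conj(z) y_j), with [A] moved across by its adjoint; the phases 1, ['i] and [- 'i]
    give the real part, the imaginary part and its opposite. [Wh] does the same for [h]. *)
Let Wy (z : C) j : 'cV[C]_N * 'cV[C]_L := (hermt A *m (z *: delta_mx j 0), z *: delta_mx j 0).
Let Wh (z : C) i : 'cV[C]_N * 'cV[C]_L := (z *: delta_mx i 0, 0).
Local Notation cov := (lin_cov Cs noise).

Let psdE : herm_psd noise.
Proof. exact: herm_psd_scalar (ltW eta0). Qed.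

Let mix W W' := lin_mixture psdC psdE mh mn hcf ncf hn W W'.
Let psd k W W' := lin_psd psdC psdE k W W'.
Let mlin W := measurable_lin mh mn W.

Let lin_Wy z j t : lin h n (Wy z j) t = complex.Re (conjc z * y t j 0).
Proof. by rewrite /lin/= -rdot_mulmx -rdotDr rdot_unit. Qed.

Let lin_Wh z i t : lin h n (Wh z i) t = complex.Re (conjc z * h t i 0).
Proof. by rewrite /lin/= rdot0l addr0 rdot_unit. Qed.

Let cov_yy k z i z' j : cov k (Wy z i) (Wy z' j) = complex.Re (conjc z * Cy k i j * z') / 2.
Proof. by rewrite /lin_cov/= -bform_mulmx -bform_add bform_unit. Qed.

Let cov_sym k W W' : cov k W W' = cov k W' W.
Proof.
by rewrite /lin_cov (bform_sym W.1 W'.1 (psdC k).1) (bform_sym W.2 W'.2 psdE.1).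
Qed.

Let cov_yh k z j z' i :
  cov k (Wy z j) (Wh z' i) = complex.Re (conjc z' * (Cs k *m hermt A) i j * z) / 2.
Proof. by rewrite cov_sym /lin_cov/= -bform_mulmxr bform0l addr0 bform_unit. Qed.

(** The signal contributes a nonnegative diagonal and the noise adds [eta2], so the variances
    required by the sign formulas are positive. *)
Let Cy_gt0 k j : 0 < complex.Re (Cy k j j).
Proof.
rewrite /Cy mxE ReD -[X in X + _]mul1r.
have -> : 1 * complex.Re ((A *m Cs k *m hermt A) j j) =
    bform (A *m Cs k *m hermt A) (1 *: delta_mx j 0) (1 *: delta_mx j 0).
  by rewrite bform_unit conjc1 !mul1r mulr1.
rewrite bform_mulmx ltr_wpDl ?bform_ge0//.
by rewrite !mxE eqxx mulr1n mulr1.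
Qed.

Let S_gt0 k j : 0 < S k j. Proof. by rewrite sqrtr_gt0. Qed.

Let var_y k z j : conjc z * z = 1 -> cov k (Wy z j) (Wy z j) = complex.Re (Cy k j j) / 2.
Proof. by move=> z1; rewrite cov_yy mulrAC z1 mul1r. Qed.

Let sd_y k z j : conjc z * z = 1 ->
  Num.sqrt (cov k (Wy z j) (Wy z j)) = S k j / Num.sqrt 2.
Proof. by move=> z1; rewrite var_y// sqrtrM ?ltW// sqrtrV. Qed.

Let s2_gt0 : 0 < Num.sqrt 2 :> R. Proof. by rewrite sqrtr_gt0. Qed.

Let E_lin_lin W W' : \int[P]_t (lin h n W t * lin h n W' t) = \sum_k p k * cov k W W'.
Proof. exact: (mixture_moment p1 (mlin W) (mlin W') (mix W W') (fun k => psd k W W')). Qed.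

Let i_lin_lin W W' : Rintegrable P (fun t => lin h n W t * lin h n W' t).
Proof. exact: (Rintegrable_mixtureM p1 (mlin W) (mlin W') (mix W W') (fun k => psd k W W')). Qed.

Let i_lin W : Rintegrable P (lin h n W).
Proof. exact: (Rintegrable_mixturer p1 (mlin W) (mix W W) (fun k => psd k W W)). Qed.

Let i_sg_lin W W' : Rintegrable P (fun t => Num.sg (lin h n W t) * lin h n W' t).
Proof.
apply: (Rintegrable_le _ _ (Rintegrable_norm (i_lin W'))).
  by apply: measurable_funM; [apply: measurable_fun_sgr|]; exact: mlin.
by move=> t; rewrite normrM ler_piMl// normr_sg lern1 leq_b1.
Qed.

Let i_sg_sg W W' : Rintegrable P (fun t => Num.sg (lin h n W t) * Num.sg (lin h n W' t)).
Proof.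
apply: (Rintegrable_bounded P (M := 1)) => [|t].
  by apply: measurable_funM; apply: measurable_fun_sgr; exact: mlin.
by rewrite normrM mulr_ile1// normr_sg lern1 leq_b1.
Qed.

(** The standard deviation of a real or imaginary part is [S k j / Num.sqrt 2], whence the factor
    [Num.sqrt 2], later cancelled by the normalization of [Qc]. *)
Let E_sg_lin z j W : conjc z * z = 1 ->
  \int[P]_t (Num.sg (lin h n (Wy z j) t) * lin h n W t) =
  Num.sqrt (2 / pi) * Num.sqrt 2 * \sum_k p k * (cov k (Wy z j) W / S k j).
Proof.
move=> z1.
rewrite (mixture_sgr_mul p1 (mlin (Wy z j)) (mlin W) (mix _ W) (fun k => psd k _ W)).
  rewrite -mulrA; congr (_ * _); rewrite mulr_sumr; apply: eq_bigr => k _.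
  by rewrite sd_y//; field; rewrite !gt_eqF.
by move=> k; rewrite var_y// divr_gt0.
Qed.

Let E_sg_sg z i z' j : conjc z * z = 1 -> conjc z' * z' = 1 ->
  \int[P]_t (Num.sg (lin h n (Wy z i) t) * Num.sg (lin h n (Wy z' j) t)) =
  2 / pi * \sum_k p k * asin (complex.Re (conjc z * Cy k i j * z') / (S k i * S k j)).
Proof.
move=> z1 z1'.
rewrite (mixture_sgr_sgr p1 (mlin (Wy z i)) (mlin (Wy z' j)) (mix _ _) (fun k => psd k _ _)).
- congr (_ * _); apply: eq_bigr => k _; congr (_ * asin _).
  rewrite !sd_y// cov_yy.
  have s22 : (2 : R) = Num.sqrt 2 * Num.sqrt 2 by rewrite -expr2 sqr_sqrtr.
  rewrite [X in _ / X / _]s22; field.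
  by rewrite !gt_eqF.
- by move=> k; rewrite var_y// divr_gt0.
- by move=> k; rewrite var_y// divr_gt0.
Qed.

Let E_lin_linD W1 W2 W3 W4 :
  \int[P]_t (lin h n W1 t * lin h n W2 t + lin h n W3 t * lin h n W4 t) =
  \sum_k p k * (cov k W1 W2 + cov k W3 W4).
Proof.
apply: (etrans (RintegralD measurableT (i_lin_lin W1 W2) (i_lin_lin W3 W4))).
apply: (etrans (congr2 +%R (E_lin_lin W1 W2) (E_lin_lin W3 W4))).
by rewrite -big_split; apply: eq_bigr => k _; rewrite mulrDr.
Qed.

Let E_lin_linB W1 W2 W3 W4 :
  \int[P]_t (lin h n W1 t * lin h n W2 t - lin h n W3 t * lin h n W4 t) =
  \sum_k p k * (cov k W1 W2 - cov k W3 W4).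
Proof.
apply: (etrans (RintegralB measurableT (i_lin_lin W1 W2) (i_lin_lin W3 W4))).
apply: (etrans (congr2 (fun u v => u - v) (E_lin_lin W1 W2) (E_lin_lin W3 W4))).
by rewrite -sumrB; apply: eq_bigr => k _; rewrite mulrBr.
Qed.

Let E_sg_linD z z' j W W' : conjc z * z = 1 -> conjc z' * z' = 1 ->
  \int[P]_t ((Num.sqrt 2)^-1 * (Num.sg (lin h n (Wy z j) t) * lin h n W t +
    Num.sg (lin h n (Wy z' j) t) * lin h n W' t)) =
  Num.sqrt (2 / pi) * \sum_k p k * ((cov k (Wy z j) W + cov k (Wy z' j) W') / S k j).
Proof.
move=> z1 z1'; have i1 := i_sg_lin (Wy z j) W; have i2 := i_sg_lin (Wy z' j) W'.
apply: (etrans (RintegralZl _ measurableT (RintegrableD i1 i2))).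
apply: (etrans (congr1 ( *%R _) (etrans (RintegralD measurableT i1 i2)
  (congr2 +%R (E_sg_lin j W z1) (E_sg_lin j W' z1'))))).
rewrite -mulrDr -big_split /= mulrA mulrCA mulVf ?gt_eqF// mulr1; congr (_ * _).
by apply: eq_bigr => k _; rewrite -mulrDr mulrDl.
Qed.

Let E_sg_linB z z' j W W' : conjc z * z = 1 -> conjc z' * z' = 1 ->
  \int[P]_t ((Num.sqrt 2)^-1 * (Num.sg (lin h n (Wy z j) t) * lin h n W t -
    Num.sg (lin h n (Wy z' j) t) * lin h n W' t)) =
  Num.sqrt (2 / pi) * \sum_k p k * ((cov k (Wy z j) W - cov k (Wy z' j) W') / S k j).
Proof.
move=> z1 z1'; have i1 := i_sg_lin (Wy z j) W; have i2 := i_sg_lin (Wy z' j) W'.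
apply: (etrans (RintegralZl _ measurableT (RintegrableB i1 i2))).
apply: (etrans (congr1 ( *%R _) (etrans (RintegralB measurableT i1 i2)
  (congr2 (fun u v => u - v) (E_sg_lin j W z1) (E_sg_lin j W' z1'))))).
rewrite -mulrBr -sumrB mulrA mulrCA mulVf ?gt_eqF// mulr1; congr (_ * _).
by apply: eq_bigr => k _; rewrite -mulrBr mulrBl.
Qed.

Let rho k i j z z' := asin (complex.Re (conjc z * Cy k i j * z') / (S k i * S k j)).

Let E_sg_sgD z1 z2 z3 z4 i j : conjc z1 * z1 = 1 -> conjc z2 * z2 = 1 ->
  conjc z3 * z3 = 1 -> conjc z4 * z4 = 1 ->
  \int[P]_t (2^-1 * (Num.sg (lin h n (Wy z1 i) t) * Num.sg (lin h n (Wy z2 j) t) +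
    Num.sg (lin h n (Wy z3 i) t) * Num.sg (lin h n (Wy z4 j) t))) =
  2 / pi * \sum_k p k * ((rho k i j z1 z2 + rho k i j z3 z4) / 2).
Proof.
move=> u1 u2 u3 u4.
have i1 := i_sg_sg (Wy z1 i) (Wy z2 j); have i2 := i_sg_sg (Wy z3 i) (Wy z4 j).
apply: (etrans (RintegralZl _ measurableT (RintegrableD i1 i2))).
apply: (etrans (congr1 ( *%R _) (etrans (RintegralD measurableT i1 i2)
  (congr2 +%R (E_sg_sg i j u1 u2) (E_sg_sg i j u3 u4))))).
rewrite -mulrDr -big_split /= mulrCA; congr (_ * _); rewrite mulr_sumr.
by apply: eq_bigr => k _; rewrite -mulrDr mulrCA [2^-1 * _]mulrC.
Qed.

Let unit1 : conjc 1 * 1 = 1 :> C. Proof. by rewrite mulr1 conjc1. Qed.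
Let uniti : conjc 'i * 'i = 1 :> C.
Proof. by apply/eqP; rewrite eq_complex/= !mul0r !mulr0 mulN1r opprK !addr0 add0r !eqxx. Qed.
Let unitNi : conjc (- 'i) * (- 'i) = 1 :> C.
Proof. by rewrite rmorphN mulrNN uniti. Qed.

Let Re_y j t : complex.Re (y t j 0) = lin h n (Wy 1 j) t.
Proof. by rewrite lin_Wy conjc1 mul1r. Qed.
Let Im_y j t : complex.Im (y t j 0) = lin h n (Wy 'i j) t.
Proof. by rewrite lin_Wy ReM/= mul0r sub0r mulN1r opprK. Qed.
Let ImN_y j t : - complex.Im (y t j 0) = lin h n (Wy (- 'i) j) t.
Proof. by rewrite lin_Wy ReM/= oppr0 mul0r sub0r opprK mul1r. Qed.
Let Re_h i t : complex.Re (h t i 0) = lin h n (Wh 1 i) t.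
Proof. by rewrite lin_Wh conjc1 mul1r. Qed.
Let Im_h i t : complex.Im (h t i 0) = lin h n (Wh 'i i) t.
Proof. by rewrite lin_Wh ReM/= mul0r sub0r mulN1r opprK. Qed.

Lemma Re_Qc (x : C) : complex.Re (Qc x) = Num.sg (complex.Re x) / Num.sqrt 2.
Proof. by rewrite /Qc -fmorphV mulrC ReZ mulrC. Qed.

Lemma Im_Qc (x : C) : complex.Im (Qc x) = Num.sg (complex.Im x) / Num.sqrt 2.
Proof. by rewrite /Qc -fmorphV mulrC ImZ mulrC. Qed.

Lemma complex_ext (u v : C) : complex.Re u = complex.Re v -> complex.Im u = complex.Im v -> u = v.
Proof. by case: u v => a b [c e] /= -> ->. Qed.

Let Re_r j t : complex.Re (r t j 0) = Num.sg (lin h n (Wy 1 j) t) / Num.sqrt 2.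
Proof. by rewrite /r /Qvec mxE Re_Qc Re_y. Qed.
Let Im_r j t : complex.Im (r t j 0) = Num.sg (lin h n (Wy 'i j) t) / Num.sqrt 2.
Proof. by rewrite /r /Qvec mxE Im_Qc Im_y. Qed.

(** The minus sign in the imaginary part of an outer product is absorbed into a phase, so that
    [E_sg_sgD] also serves there. *)
Let sg_lin_Ni j t : - Num.sg (lin h n (Wy 'i j) t) = Num.sg (lin h n (Wy (- 'i) j) t).
Proof. by rewrite -ImN_y -Im_y sgrN. Qed.

Lemma Re_outer m q (u : 'cV[C]_m) (v : 'cV[C]_q) i j : complex.Re ((u *m hermt v) i j) =
  complex.Re (u i 0) * complex.Re (v j 0) + complex.Im (u i 0) * complex.Im (v j 0).
Proof. by rewrite !mxE big_ord1 /hermt !mxE ReM /cconj/= mulrN opprK. Qed.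

Lemma Im_outer m q (u : 'cV[C]_m) (v : 'cV[C]_q) i j : complex.Im ((u *m hermt v) i j) =
  complex.Im (u i 0) * complex.Re (v j 0) - complex.Re (u i 0) * complex.Im (v j 0).
Proof. by rewrite !mxE big_ord1 /hermt !mxE ImM /cconj/= mulrN addrC. Qed.

Lemma mulmx_diag_isqrt m q (X : 'M[C]_(m, q)) (D : 'M[C]_q) i j :
  (X *m diag_isqrt D) i j = ((Num.sqrt (complex.Re (D j j)))^-1)%:C * X i j.
Proof. by rewrite /diag_isqrt mul_mx_diag !mxE mulrC. Qed.

Lemma mul_diag_isqrt_mx m q (X : 'M[C]_(m, q)) (D : 'M[C]_m) i j :
  (diag_isqrt D *m X) i j = ((Num.sqrt (complex.Re (D i i)))^-1)%:C * X i j.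
Proof. by rewrite /diag_isqrt mul_diag_mx !mxE. Qed.

Lemma Re_scaled_sum (w : 'I_K -> R) (c : R) m q (X : 'I_K -> 'M[C]_(m, q)) i j :
  complex.Re ((c%:C *: \sum_k (w k)%:C *: X k) i j) = c * \sum_k w k * complex.Re (X k i j).
Proof.
by rewrite mxE ReZ summxE Re_sum; congr (_ * _); apply: eq_bigr => k _; rewrite mxE ReZ.
Qed.

Lemma Im_scaled_sum (w : 'I_K -> R) (c : R) m q (X : 'I_K -> 'M[C]_(m, q)) i j :
  complex.Im ((c%:C *: \sum_k (w k)%:C *: X k) i j) = c * \sum_k w k * complex.Im (X k i j).
Proof.
by rewrite mxE ImZ summxE Im_sum; congr (_ * _); apply: eq_bigr => k _; rewrite mxE ImZ.
Qed.

Let conj1_mul1 (x : C) : complex.Re (conjc 1 * x * 1) = complex.Re x.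
Proof. by rewrite conjc1 mul1r mulr1. Qed.
Let conji_muli (x : C) : complex.Re (conjc 'i * x * 'i) = complex.Re x.
Proof. by rewrite mulrAC uniti mul1r. Qed.
Let conji_mul1 (x : C) : complex.Re (conjc 'i * x * 1) = complex.Im x.
Proof. by rewrite mulr1 ReM/= mul0r sub0r mulN1r opprK. Qed.
Let conj1_muli (x : C) : complex.Re (conjc 1 * x * 'i) = - complex.Im x.
Proof. by rewrite conjc1 mul1r ReM/= mulr0 mulr1 sub0r. Qed.
Let conj1_mulNi (x : C) : complex.Re (conjc 1 * x * - 'i) = complex.Im x.
Proof. by rewrite conjc1 mul1r ReM/= oppr0 mulr0 mulrN1 opprK add0r. Qed.

(** By circular symmetry each of the two real products in an entry contributes half of the real,
    respectively imaginary, part of [Cy k i j]. *)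
Lemma cE_yy : cE P (fun t => y t *m hermt (y t)) = \sum_k (p k)%:C *: Cy k.
Proof.
rewrite -[RHS]scale1r; apply/matrixP => i j; rewrite [LHS]mxE; apply: complex_ext => /=.
  rewrite (Re_scaled_sum p 1) mul1r.
  under eq_Rintegral do rewrite Re_outer !Re_y !Im_y.
  rewrite E_lin_linD; apply: eq_bigr => k _; congr (_ * _).
  by rewrite !cov_yy conj1_mul1 conji_muli -splitr.
rewrite (Im_scaled_sum p 1) mul1r.
under eq_Rintegral do rewrite Im_outer !Re_y !Im_y.
rewrite E_lin_linB; apply: eq_bigr => k _; congr (_ * _).
by rewrite !cov_yy conji_mul1 conj1_muli mulNr opprK -splitr.
Qed.

Let ry_re (x1 x2 x3 x4 s : R) : x1 / s * x2 + x3 / s * x4 = s^-1 * (x1 * x2 + x3 * x4).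
Proof. by ring. Qed.
Let ry_im (x1 x2 x3 x4 s : R) : x1 / s * x2 - x3 / s * x4 = s^-1 * (x1 * x2 - x3 * x4).
Proof. by ring. Qed.
Let hr_re (x1 x2 x3 x4 s : R) : x1 * (x2 / s) + x3 * (x4 / s) = s^-1 * (x2 * x1 + x4 * x3).
Proof. by ring. Qed.
Let hr_im (x1 x2 x3 x4 s : R) : x1 * (x2 / s) - x3 * (x4 / s) = s^-1 * (x2 * x1 - x4 * x3).
Proof. by ring. Qed.
Let rr_re (x1 x2 x3 x4 s : R) :
  x1 / s * (x2 / s) + x3 / s * (x4 / s) = s^-1 * s^-1 * (x1 * x2 + x3 * x4).
Proof. by ring. Qed.
Let rr_im (x1 x2 x3 x4 s : R) :
  x1 / s * (x2 / s) - x3 / s * (x4 / s) = s^-1 * s^-1 * (x1 * x2 + x3 * - x4).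
Proof. by ring. Qed.

(** Entrywise [E_sg_linD] and [E_sg_linB]: the division by [S k i], the scale of the quantized
    entry, becomes a row scaling by [diag_isqrt]. *)
Lemma cE_ry : cE P (fun t => r t *m hermt (y t)) =
  (Num.sqrt (2 / pi))%:C *: \sum_k (p k)%:C *: (diag_isqrt (Cy k) *m Cy k).
Proof.
apply/matrixP => i j; rewrite [LHS]mxE; apply: complex_ext => /=.
  rewrite Re_scaled_sum.
  under eq_Rintegral do rewrite Re_outer Re_r Im_r Re_y Im_y ry_re.
  rewrite (E_sg_linD _ _ _ unit1 uniti); congr (_ * _); apply: eq_bigr => k _; congr (_ * _).
  by rewrite mul_diag_isqrt_mx ReZ !cov_yy conj1_mul1 conji_muli -splitr mulrC.
rewrite Im_scaled_sum.
under eq_Rintegral do rewrite Im_outer Re_r Im_r Re_y Im_y ry_im.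
rewrite (E_sg_linB _ _ _ uniti unit1); congr (_ * _); apply: eq_bigr => k _; congr (_ * _).
by rewrite mul_diag_isqrt_mx ImZ !cov_yy conji_mul1 conj1_muli mulNr opprK -splitr mulrC.
Qed.

(** Here the quantized factor indexes the columns, so [diag_isqrt] multiplies on the right. *)
Lemma cE_hr : cE P (fun t => h t *m hermt (r t)) =
  (Num.sqrt (2 / pi))%:C *: \sum_k (p k)%:C *: (Cs k *m hermt A *m diag_isqrt (Cy k)).
Proof.
apply/matrixP => i j; rewrite [LHS]mxE; apply: complex_ext => /=.
  rewrite Re_scaled_sum.
  under eq_Rintegral do rewrite Re_outer Re_r Im_r Re_h Im_h hr_re.
  rewrite (E_sg_linD _ _ _ unit1 uniti); congr (_ * _); apply: eq_bigr => k _; congr (_ * _).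
  by rewrite mulmx_diag_isqrt ReZ !cov_yh conj1_mul1 conji_muli -splitr mulrC.
rewrite Im_scaled_sum.
under eq_Rintegral do rewrite Im_outer Re_r Im_r Re_h Im_h hr_im.
rewrite (E_sg_linB _ _ _ unit1 uniti); congr (_ * _); apply: eq_bigr => k _; congr (_ * _).
by rewrite mulmx_diag_isqrt ImZ !cov_yh conji_mul1 conj1_muli mulNr opprK -splitr mulrC.
Qed.

(** The phase pairs (1, 1) and (i, i) both have correlation Re of the normalized entry, while (i, 1)
    and (1, -i) both have its Im. The two equal arcsines are averaged by the factor 1/2 coming from
    [Qc]. *)
Lemma cE_rr : cE P (fun t => r t *m hermt (r t)) =
  (2 / pi)%:C *: \sum_k (p k)%:C *: asin_cmx (diag_isqrt (Cy k) *m Cy k *m diag_isqrt (Cy k)).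
Proof.
have half : (Num.sqrt 2)^-1 * (Num.sqrt 2)^-1 = 2^-1 :> R by rewrite -invfM -expr2 sqr_sqrtr.
have bar k i j : (diag_isqrt (Cy k) *m Cy k *m diag_isqrt (Cy k)) i j =
    ((S k i * S k j)^-1)%:C * Cy k i j.
  by rewrite mulmx_diag_isqrt mul_diag_isqrt_mx mulrA -rmorphM -invfM [S k i * _]mulrC.
apply/matrixP => i j; rewrite [LHS]mxE; apply: complex_ext => /=.
  rewrite Re_scaled_sum.
  under eq_Rintegral do rewrite Re_outer !Re_r !Im_r rr_re half.
  rewrite (E_sg_sgD i j unit1 unit1 uniti uniti); congr (_ * _); apply: eq_bigr => k _; congr (_ * _).
  by rewrite mxE /= bar ReZ [_^-1 * _]mulrC /rho conj1_mul1 conji_muli mulrDl -splitr.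
rewrite Im_scaled_sum.
under eq_Rintegral do rewrite Im_outer !Re_r !Im_r rr_im half sg_lin_Ni.
rewrite (E_sg_sgD i j uniti unit1 unit1 unitNi); congr (_ * _); apply: eq_bigr => k _; congr (_ * _).
by rewrite mxE /= bar ImZ [_^-1 * _]mulrC /rho conji_mul1 conj1_mulNi mulrDl -splitr.
Qed.

End bussgang.

(** * The Kronecker observation model *)

Unset Implicit Arguments.
Local Open Scope ring_scope.
Local Open Scope complex_scope.

Theorem theorem1 (R : realType) (N M K : nat) (p : 'I_K -> R)
  (Cs : 'I_K -> 'M[R[i]]_N) (a : 'cV[R[i]]_M) (eta2 : R)
  (d : measure_display) (T : measurableType d) (P : probability T R)
  (h : T -> 'cV[R[i]]_N) (n : T -> 'cV[R[i]]_(M * N)) :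
  (forall k, 0 < p k) -> \sum_(k < K) p k = 1 ->
  (forall k, herm_psd (Cs k)) ->
  (hermt a *m a) 0 0 = M%:R ->
  0 < eta2 ->
  cmx_measurable h -> cmx_measurable n ->
  has_cf P h (gmix_cf p Cs) ->
  has_cf P n (cgauss_cf (eta2%:C *: 1%:M)) ->
  cindep P h n ->
  let A := kronI N a in
  let y := fun t => A *m h t + n t in
  let r := fun t => Qvec (y t) in
  let Cyk := fun k => A *m Cs k *m hermt A + eta2%:C *: 1%:M in
  let Cy := \sum_(k < K) (p k)%:C *: Cyk k in
  let Cbar := fun k => diag_isqrt (Cyk k) *m Cyk k *m diag_isqrt (Cyk k) in
  let B := cE P (fun t => r t *m hermt (y t)) *m invmx (cE P (fun t => y t *m hermt (y t))) in
  let Chr := cE P (fun t => h t *m hermt (r t)) in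
  let Cr := cE P (fun t => r t *m hermt (r t)) in
  [/\ B = (Num.sqrt (2 / pi))%:C *:
          \sum_(k < K) (p k)%:C *: (diag_isqrt (Cyk k) *m Cyk k *m invmx Cy),
      Chr = (Num.sqrt (2 / pi))%:C *:
          \sum_(k < K) (p k)%:C *: (Cs k *m hermt A *m diag_isqrt (Cyk k)) &
      Cr = (2 / pi)%:C *: \sum_(k < K) (p k)%:C *: asin_cmx (Cbar k)].
Proof.
move=> _ p1 psdC _ eta0 mh mn hcf ncf hn A y r Cyk Cy Cbar B Chr Cr.
split; [|exact: cE_hr|exact: cE_rr].
(* The second moment of [y] is exactly [Cy], so its inverse distributes over the sum from the
   right. *)
rewrite /B (cE_ry _ p1 psdC eta0 mh mn hcf ncf hn) (cE_yy _ p1 psdC eta0 mh mn hcf ncf hn).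
rewrite -scalemxAl mulmx_suml; congr (_ *: _); apply: eq_bigr => k _.
by rewrite -scalemxAl.
Qed.
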